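(* Let $\mathbf{C}$ be a category with a class $W$ of arrows satisfying the conditions CF1, CF2, CF3, let $\mathcal{D}$ be a bicategory, and let $F,G\colon\mathbf{C}\to\mathcal{D}$ be $W$-homomorphisms (homomorphisms sending elements of $W$ to internal equivalences). An icon $\psi\colon F\Rightarrow G$ is a $W$-icon if and only if the corresponding vertical transformation $\mathbf{Dbl}(\psi)\colon\mathbf{Dbl}(F)\Rightarrow\mathbf{Dbl}(G)$ is a vertical $W$-transformation.
   Context: Conditions on $W$: CF1: $W$ contains all isomorphisms and is closed under composition. CF2: for $f\colon C\to B$ and $w\colon A\to B$ with $w\in W$ there are $\bar f\colon D\to A$ and $\bar w\colon D\to C$ with $\bar w\in W$ and $w\bar f=f\bar w$. CF3: if $w\in W$ and $wf=wg$ there is $\tilde w\in W$ with $f\tilde w=g\tilde w$. A category is regarded as a bicategory with only identity 2-cells. An icon $\psi\colon F\Rightarrow G$ exists only if $F,G$ agree on objects and consists of 2-cells $\psi_f\colon Ff\Rightarrow Gf$ compatible with composition and units. It is a *$W$-icon* if for each $w\colon A\to B$ in $W$ and choice of pseudo-inverses $(Fw)^*$, $(Gw)^*$ of $Fw$, $Gw$, with invertible 2-cells $\eta_{Fw}\colon1_{FA}\Rightarrow(Fw)^*\circ Fw$, $\varepsilon_{Fw}\colon Fw\circ(Fw)^*\Rightarrow1_{FB}$ and similarly for $G$, there is a 2-cell $\psi_w^*\colon(Fw)^*\Rightarrow(Gw)^*$ such that the composites $$1_{FA}\xrightarrow{\eta_{Fw}}(Fw)^*\circ Fw\xrightarrow{\psi^*_w*\psi_w}(Gw)^*\circ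 Gw\xrightarrow{\eta_{Gw}^{-1}}1_{GA},\qquad1_{FB}\xrightarrow{\varepsilon_{Fw}^{-1}}Fw\circ(Fw)^*\xrightarrow{\psi_w*\psi_w^*}Gw\circ(Gw)^*\xrightarrow{\varepsilon_{Gw}}1_{GB}$$ are identity 2-cells. In a double category, $\circ$ is horizontal composition, $\cdot$ vertical composition ($\beta\cdot\alpha$ has $\alpha$ on top), $d_0,d_1$ are horizontal domain and codomain, $\mathrm{Id}_A$ and $1_A$ are horizontal and vertical identity arrows, $\mathrm{id}_v$ the horizontal identity cell on a vertical arrow $v$, $1_f$ the vertical identity cell on a horizontal arrow $f$; a cell $\alpha\colon f\to g$ has top edge $f$ and bottom edge $g$. A horizontal $f\colon A\to B$ has vertical companion $v\colon A\to B$ if there are binding cells $\psi$ (top $\mathrm{Id}_A$, bottom $f$, left $1_A$, right $v$) and $\chi$ (top $f$, bottom $\mathrm{Id}_B$, left $v$, right $1_B$) with $\chi\circ\psi=1_f$ and $\chi\cdot\psi=\mathrm{id}_v$. The double category $\mathbf{Dbl}(\mathcal{B})$ for a bicategory $\mathcal{B}$: choose a composite $\varphi_{f_1,\dots,f_n}$ (a bracketed composition) of each finite path of composable arrows, the empty path at $A$ having composite $1_A$. Objects: paths $A_0\xrightarrow{f_1}\cdots\xrightarrow{f_n}A_n$ with a marked index $i_0$. There is a unique vertical arrow between two objects iff their marked objects are equal, and none otherwise. Horizontal arrows: paths with two marked indices $i_0\le i_1$, with domain the path marked at $i_0$ and codomain the path marked at $i_1$; $(i_0,i_1)$ followed by $(i_1,i_2)$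 on the same path is $(i_0,i_2)$. A double cell from $(f_1,\dots,f_n;i_0,i_1)$ to $(g_1,\dots,g_m;j_0,j_1)$ exists only if $A_{i_0}=B_{j_0}$ and $A_{i_1}=B_{j_1}$, and is a 2-cell $\varphi_{f_{i_0+1},\dots,f_{i_1}}\Rightarrow\varphi_{g_{j_0+1},\dots,g_{j_1}}$ in $\mathcal{B}$. Vertical composition is that of 2-cells; horizontal composition is horizontal composition of 2-cells conjugated by the canonical coherence isomorphisms. $\mathbf{Dbl}(F)$ applies $F$ to each arrow of a path, keeping the marks, and sends a 2-cell $\alpha$ to $F\alpha$ conjugated by coherence isomorphisms. $\mathbf{Dbl}(\psi)$ has as component at a horizontal arrow $(f_1,\dots,f_n;i_0,i_1)$ the double cell given by the horizontal composite of $\psi_{f_{i_0+1}},\dots,\psi_{f_{i_1}}$ from the chosen composite of the $Ff_i$ to that of the $Gf_i$. A *$W$-doubly marked path* is a horizontal arrow $w=(f_1,\dots,f_n;i_0,i_1)$ of $\mathbf{Dbl}(\mathbf{C})$ with $f_{i_1}\circ\cdots\circ f_{i_0+1}\in W$. Write $P=\mathbf{Dbl}(F)$, $Q=\mathbf{Dbl}(G)$ and let $\alpha\colon P\Rightarrow Q$ be a vertical transformation. For $W$-homomorphisms $F,G$, one can choose for each such $w$ horizontal arrows $(Pw)',l_{Pw},(Pw)'',r_{Pw}$ and vertically invertible cells $\varphi^l_w\colon Pw\to(Pw)'$, $\varphi^r_w\colon Pw\to(Pw)''$ such that $(Pw)'\circ l_{Pw}$ and $r_{Pw}\circ(Pw)''$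 are defined and have companions, with binding cells $\psi^l_{Pw},\chi^l_{Pw}$ and $\psi^r_{Pw},\chi^r_{Pw}$; and similarly for $Q$, with invertible cells $\hat\varphi^l_w,\hat\varphi^r_w$. Put $\alpha'_w=\hat\varphi^l_w\cdot\alpha_w\cdot(\varphi^l_w)^{-1}$, $\alpha''_w=\hat\varphi^r_w\cdot\alpha_w\cdot(\varphi^r_w)^{-1}$. Then $\alpha$ is a *vertical $W$-transformation* if for every $w$ there are double cells $\alpha^l_w\colon l_{Pw}\to l_{Qw}$, $\alpha^r_w\colon r_{Pw}\to r_{Qw}$ with $$\chi^l_{Qw}\cdot(\alpha'_w\circ\alpha^l_w)=\mathrm{id}_{d_1\alpha'_w}\cdot\chi^l_{Pw},\qquad(\alpha'_w\circ\alpha^l_w)\cdot\psi^l_{Pw}=\psi^l_{Qw}\cdot\mathrm{id}_{d_0\alpha^l_w},$$ $$\chi^r_{Qw}\cdot(\alpha^r_w\circ\alpha''_w)=\mathrm{id}_{d_1\alpha^r_w}\cdot\chi^r_{Pw},\qquad(\alpha^r_w\circ\alpha''_w)\cdot\psi^r_{Pw}=\psi^r_{Qw}\cdot\mathrm{id}_{d_0\alpha''_w}.$$ (This does not depend on the choices.)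
   Formalization: In the definition of W-icon, the pseudo-inverses with η and ε are required to satisfy the triangle identities (adjoint equivalences); for arbitrary invertible η, ε the claim is false, since even an identity icon can fail to be a W-icon. *)

(* Defs.v *)
From Stdlib Require Import ProofIrrelevance FunctionalExtensionality.

Set Implicit Arguments.
Unset Strict Implicit.
Unset Printing Implicit Defensive.

Declare Scope bicat_scope.
Delimit Scope bicat_scope with bicat.

Record bicat := Bicat {
  ob :> Type;
  hom1 : ob -> ob -> Type;
  hom2 : forall {a b}, hom1 a b -> hom1 a b -> Type;
  id1 : forall a, hom1 a a;
  comp1 : forall {a b c}, hom1 b c -> hom1 a b -> hom1 a c;
  id2 : forall {a b} (f : hom1 a b), hom2 f f;
  vcomp : forall {a b} {f g h : hom1 a b}, hom2 g h -> hom2 f g -> hom2 f h;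
  hcomp : forall {a b c} {g g' : hom1 b c} {f f' : hom1 a b},
    hom2 g g' -> hom2 f f' -> hom2 (comp1 g f) (comp1 g' f');
  assoc : forall {a b c d} (h : hom1 c d) (g : hom1 b c) (f : hom1 a b),
    hom2 (comp1 (comp1 h g) f) (comp1 h (comp1 g f));
  assoc_inv : forall {a b c d} (h : hom1 c d) (g : hom1 b c) (f : hom1 a b),
    hom2 (comp1 h (comp1 g f)) (comp1 (comp1 h g) f);
  lunit : forall {a b} (f : hom1 a b), hom2 (comp1 (id1 b) f) f;
  lunit_inv : forall {a b} (f : hom1 a b), hom2 f (comp1 (id1 b) f);
  runit : forall {a b} (f : hom1 a b), hom2 (comp1 f (id1 a)) f;
  runit_inv : forall {a b} (f : hom1 a b), hom2 f (comp1 f (id1 a));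

  vcompA : forall a b (f g h k : hom1 a b)
    (z : hom2 h k) (y : hom2 g h) (x : hom2 f g),
    vcomp z (vcomp y x) = vcomp (vcomp z y) x;
  vcomp1l : forall a b (f g : hom1 a b) (x : hom2 f g), vcomp (id2 g) x = x;
  vcomp1r : forall a b (f g : hom1 a b) (x : hom2 f g), vcomp x (id2 f) = x;
  hcomp1 : forall a b c (g : hom1 b c) (f : hom1 a b),
    hcomp (id2 g) (id2 f) = id2 (comp1 g f);
  interchange : forall a b c (g g' g'' : hom1 b c) (f f' f'' : hom1 a b)
    (y' : hom2 g' g'') (y : hom2 g g') (x' : hom2 f' f'') (x : hom2 f f'),
    hcomp (vcomp y' y) (vcomp x' x) = vcomp (hcomp y' x') (hcomp y x);

  assoc_nat : forall a b c d (h h' : hom1 c d) (g g' : hom1 b c) (f f' : hom1 a b)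
    (z : hom2 h h') (y : hom2 g g') (x : hom2 f f'),
    vcomp (assoc h' g' f') (hcomp (hcomp z y) x)
    = vcomp (hcomp z (hcomp y x)) (assoc h g f);
  lunit_nat : forall a b (f f' : hom1 a b) (x : hom2 f f'),
    vcomp (lunit f') (hcomp (id2 (id1 b)) x) = vcomp x (lunit f);
  runit_nat : forall a b (f f' : hom1 a b) (x : hom2 f f'),
    vcomp (runit f') (hcomp x (id2 (id1 a))) = vcomp x (runit f);

  assocK : forall a b c d (h : hom1 c d) (g : hom1 b c) (f : hom1 a b),
    vcomp (assoc_inv h g f) (assoc h g f) = id2 _;
  assocVK : forall a b c d (h : hom1 c d) (g : hom1 b c) (f : hom1 a b),
    vcomp (assoc h g f) (assoc_inv h g f) = id2 _;
  lunitK : forall a b (f : hom1 a b), vcomp (lunit_inv f) (lunit f) = id2 _;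
  lunitVK : forall a b (f : hom1 a b), vcomp (lunit f) (lunit_inv f) = id2 _;
  runitK : forall a b (f : hom1 a b), vcomp (runit_inv f) (runit f) = id2 _;
  runitVK : forall a b (f : hom1 a b), vcomp (runit f) (runit_inv f) = id2 _;

  pentagon : forall a b c d e
    (k : hom1 d e) (h : hom1 c d) (g : hom1 b c) (f : hom1 a b),
    vcomp (assoc k h (comp1 g f)) (assoc (comp1 k h) g f)
    = vcomp (hcomp (id2 k) (assoc h g f))
        (vcomp (assoc k (comp1 h g) f) (hcomp (assoc k h g) (id2 f)));
  triangle : forall a b c (g : hom1 b c) (f : hom1 a b),
    vcomp (hcomp (id2 g) (lunit f)) (assoc g (id1 b) f)
    = hcomp (runit g) (id2 f)
}.

Arguments hom1 {_}.
Arguments id1 {_}.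

Notation "g ∘ f" := (comp1 g f) (at level 40, left associativity) : bicat_scope.
Notation "y ⋆ x" := (hcomp y x) (at level 42, left associativity) : bicat_scope.
Notation "y • x" := (vcomp y x) (at level 45, left associativity) : bicat_scope.
Notation "f ⇒ g" := (hom2 f g) (at level 60, no associativity) : bicat_scope.
Local Open Scope bicat_scope.

Definition inverse2 {B : bicat} {a b : B} {f g : hom1 a b}
    (x : f ⇒ g) (y : g ⇒ f) : Prop :=
  y • x = id2 f /\ x • y = id2 g.

Definition internal_equivalence {B : bicat} {a b : B} (f : hom1 a b) : Prop :=
  exists (g : hom1 b a)
         (eta : id1 a ⇒ g ∘ f) (eta' : g ∘ f ⇒ id1 a)
         (eps : f ∘ g ⇒ id1 b) (eps' : id1 b ⇒ f ∘ g),
    inverse2 eta eta' /\ inverse2 eps eps'.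

(** A pseudo-inverse together with the unit and the counit of an adjoint
    equivalence.  The triangle identities matter whenever both the unit and the
    counit occur in one condition, as they do for W-icons: for independently
    chosen invertible cells even an identity icon would fail that condition. *)
Record pseudo_inverse {B : bicat} {a b : B} (f : hom1 a b) := PseudoInverse {
  star : hom1 b a;
  eta : id1 a ⇒ star ∘ f;
  eta_inv : star ∘ f ⇒ id1 a;
  eps : f ∘ star ⇒ id1 b;
  eps_inv : id1 b ⇒ f ∘ star;
  eta_inverse : inverse2 eta eta_inv;
  eps_inverse : inverse2 eps eps_inv;
  triangle_f :
    lunit f • (eps ⋆ id2 f) • assoc_inv f star f • (id2 f ⋆ eta) • runit_inv f
    = id2 f;
  triangle_star :
    runit star • (id2 star ⋆ eps) • assoc star f star • (eta ⋆ id2 star)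
      • lunit_inv star
    = id2 star
}.

(** 2-cells between arrows whose endpoints are only provably equal: the components
    of an icon [F ⇒ G], where [F a = G a], and the cells of [Dbl], where the marked
    objects are equal, are of this kind. *)

Definition cast1 {B : bicat} {a a' b b' : B} (u : a = a') (v : b = b')
    (f : hom1 a b) : hom1 a' b' :=
  match u in _ = x, v in _ = y return hom1 x y with
  | eq_refl, eq_refl => f
  end.

Definition hom2_over {B : bicat} {a a' b b' : B} (u : a = a') (v : b = b')
    (f : hom1 a b) (g : hom1 a' b') : Type :=
  cast1 u v f ⇒ g.

Definition id_over {B : bicat} {a a' : B} (u : a = a') :
    hom2_over u u (id1 a) (id1 a') :=
  match u in _ = x return hom2_over u u (id1 a) (id1 x) with
  | eq_refl => id2 (id1 a)
  end.

Definition vcomp_over {B : bicat} {a a' a'' b b' b'' : B}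
    {u : a = a'} {v : b = b'} {u' : a' = a''} {v' : b' = b''}
    {f : hom1 a b} {g : hom1 a' b'} {h : hom1 a'' b''} :
    hom2_over u' v' g h -> hom2_over u v f g ->
    hom2_over (eq_trans u u') (eq_trans v v') f h :=
  match u' as u0 in _ = x, v' as v0 in _ = y
    return forall h : hom1 x y, hom2_over u0 v0 g h -> hom2_over u v f g ->
      hom2_over (eq_trans u u0) (eq_trans v v0) f h
  with
  | eq_refl, eq_refl => fun h y x => y • x
  end h.

Definition hcomp_over {B : bicat} {a a' b b' c c' : B}
    {u : a = a'} {v : b = b'} {w : c = c'}
    {g : hom1 b c} {g' : hom1 b' c'} {f : hom1 a b} {f' : hom1 a' b'} :
    hom2_over v w g g' -> hom2_over u v f f' ->
    hom2_over u w (g ∘ f) (g' ∘ f') :=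
  match u as u0 in _ = x, v as v0 in _ = y, w as w0 in _ = z
    return forall (g' : hom1 y z) (f' : hom1 x y),
      hom2_over v0 w0 g g' -> hom2_over u0 v0 f f' ->
      hom2_over u0 w0 (g ∘ f) (g' ∘ f')
  with
  | eq_refl, eq_refl, eq_refl => fun g' f' y x => y ⋆ x
  end g' f'.

(** [conj_over y z x] is the pasting of [x], [z], [y] in this order. *)
Definition conj_over {B : bicat} {a a' b b' : B} {u : a = a'} {v : b = b'}
    {f0 f : hom1 a b} {g g0 : hom1 a' b'}
    (y : g ⇒ g0) (z : hom2_over u v f g) (x : f0 ⇒ f) :
    hom2_over u v f0 g0 :=
  y • z • match u as u0 in _ = x', v as v0 in _ = y'
            return cast1 u0 v0 f0 ⇒ cast1 u0 v0 f
          with eq_refl, eq_refl => x end.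

Record homomorphism (B D : bicat) := Homomorphism {
  h_ob :> B -> D;
  h_1 : forall {a b : B}, hom1 a b -> hom1 (h_ob a) (h_ob b);
  h_2 : forall {a b : B} {f g : hom1 a b}, f ⇒ g -> h_1 f ⇒ h_1 g;
  h_comp : forall {a b c : B} (g : hom1 b c) (f : hom1 a b),
    h_1 g ∘ h_1 f ⇒ h_1 (g ∘ f);
  h_comp_inv : forall {a b c : B} (g : hom1 b c) (f : hom1 a b),
    h_1 (g ∘ f) ⇒ h_1 g ∘ h_1 f;
  h_unit : forall a : B, id1 (h_ob a) ⇒ h_1 (id1 a);
  h_unit_inv : forall a : B, h_1 (id1 a) ⇒ id1 (h_ob a);

  h_id2 : forall (a b : B) (f : hom1 a b), h_2 (id2 f) = id2 (h_1 f);
  h_vcomp : forall (a b : B) (f g h : hom1 a b) (y : g ⇒ h) (x : f ⇒ g),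
    h_2 (y • x) = h_2 y • h_2 x;
  h_comp_nat : forall (a b c : B) (g g' : hom1 b c) (f f' : hom1 a b)
    (y : g ⇒ g') (x : f ⇒ f'),
    h_comp g' f' • (h_2 y ⋆ h_2 x) = h_2 (y ⋆ x) • h_comp g f;
  h_compK : forall (a b c : B) (g : hom1 b c) (f : hom1 a b),
    inverse2 (h_comp g f) (h_comp_inv g f);
  h_unitK : forall a : B, inverse2 (h_unit a) (h_unit_inv a);
  h_assoc : forall (a b c d : B) (h : hom1 c d) (g : hom1 b c) (f : hom1 a b),
    h_2 (assoc h g f) • h_comp (h ∘ g) f • (h_comp h g ⋆ id2 (h_1 f))
    = h_comp h (g ∘ f) • (id2 (h_1 h) ⋆ h_comp g f)
        • assoc (h_1 h) (h_1 g) (h_1 f);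
  h_lunit : forall (a b : B) (f : hom1 a b),
    h_2 (lunit f) • h_comp (id1 b) f • (h_unit b ⋆ id2 (h_1 f)) = lunit (h_1 f);
  h_runit : forall (a b : B) (f : hom1 a b),
    h_2 (runit f) • h_comp f (id1 a) • (id2 (h_1 f) ⋆ h_unit a) = runit (h_1 f)
}.

Record icon {B D : bicat} (F G : homomorphism B D) := Icon {
  ic_ob : forall a : B, F a = G a;
  ic_1 : forall {a b : B} (f : hom1 a b),
    hom2_over (ic_ob a) (ic_ob b) (h_1 F f) (h_1 G f);
  ic_nat : forall (a b : B) (f g : hom1 a b) (x : f ⇒ g),
    conj_over (id2 _) (ic_1 g) (h_2 F x) = conj_over (h_2 G x) (ic_1 f) (id2 _);
  ic_comp : forall (a b c : B) (g : hom1 b c) (f : hom1 a b),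
    conj_over (id2 _) (ic_1 (g ∘ f)) (h_comp F g f)
    = conj_over (h_comp G g f) (hcomp_over (ic_1 g) (ic_1 f)) (id2 _);
  ic_unit : forall a : B,
    conj_over (id2 _) (ic_1 (id1 a)) (h_unit F a)
    = conj_over (h_unit G a) (id_over (ic_ob a)) (id2 _)
}.

Record category := Category {
  c_ob :> Type;
  c_hom : c_ob -> c_ob -> Type;
  c_id : forall a, c_hom a a;
  c_comp : forall {a b c}, c_hom b c -> c_hom a b -> c_hom a c;
  c_assoc : forall a b c d (h : c_hom c d) (g : c_hom b c) (f : c_hom a b),
    c_comp h (c_comp g f) = c_comp (c_comp h g) f;
  c_idl : forall a b (f : c_hom a b), c_comp (c_id b) f = f;
  c_idr : forall a b (f : c_hom a b), c_comp f (c_id a) = f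
}.

Arguments c_hom {_}.
Arguments c_id {_}.

Definition arrow_class (C : category) := forall a b : C, c_hom a b -> Prop.

Definition is_iso {C : category} {a b : C} (f : c_hom a b) : Prop :=
  exists g : c_hom b a, c_comp g f = c_id a /\ c_comp f g = c_id b.

Definition CF1 {C : category} (W : arrow_class C) : Prop :=
  (forall (a b : C) (f : c_hom a b), is_iso f -> W a b f) /\
  (forall (a b c : C) (g : c_hom b c) (f : c_hom a b),
     W b c g -> W a b f -> W a c (c_comp g f)).

Definition CF2 {C : category} (W : arrow_class C) : Prop :=
  forall (A B K : C) (f : c_hom K B) (w : c_hom A B), W A B w ->
  exists (E : C) (f' : c_hom E A) (w' : c_hom E K),
    W E K w' /\ c_comp w f' = c_comp f w'.

Definition CF3 {C : category} (W : arrow_class C) : Prop :=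
  forall (K A B : C) (w : c_hom A B) (f g : c_hom K A), W A B w ->
  c_comp w f = c_comp w g ->
  exists (E : C) (w' : c_hom E K), W E K w' /\ c_comp f w' = c_comp g w'.

Definition locally_discrete (C : category) : bicat.
Proof.
refine
  (@Bicat C (@c_hom C) (fun a b f g => f = g) (@c_id C) (@c_comp C)
    (fun a b f => eq_refl)
    (fun a b f g h y x => eq_trans x y)
    (fun a b c g g' f f' y x => f_equal2 (@c_comp C a b c) y x)
    (fun a b c d h g f => eq_sym (c_assoc h g f))
    (fun a b c d h g f => c_assoc h g f)
    (fun a b f => c_idl f) (fun a b f => eq_sym (c_idl f))
    (fun a b f => c_idr f) (fun a b f => eq_sym (c_idr f))
    _ _ _ _ _ _ _ _ _ _ _ _ _ _ _ _);
  intros; apply proof_irrelevance.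
Defined.

Definition W_homomorphism {C : category} (W : arrow_class C) {D : bicat}
    (F : homomorphism (locally_discrete C) D) : Prop :=
  forall (A B : C) (w : c_hom A B), W A B w ->
  internal_equivalence (@h_1 _ _ F A B w).

Definition W_icon {C : category} (W : arrow_class C) {D : bicat}
    {F G : homomorphism (locally_discrete C) D} (psi : icon F G) : Prop :=
  forall (A B : C) (w : c_hom A B), W A B w ->
  forall (Fw : pseudo_inverse (@h_1 _ _ F A B w))
         (Gw : pseudo_inverse (@h_1 _ _ G A B w)),
  exists psi_star : hom2_over (ic_ob psi B) (ic_ob psi A) (star Fw) (star Gw),
    conj_over (eta_inv Gw) (hcomp_over psi_star (@ic_1 _ _ _ _ psi A B w)) (eta Fw)
      = id_over (ic_ob psi A)
    /\
    conj_over (eps Gw) (hcomp_over (@ic_1 _ _ _ _ psi A B w) psi_star) (eps_inv Fw)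
      = id_over (ic_ob psi B).

Record double_data := DoubleData {
  dob :> Type;
  hor : dob -> dob -> Type;
  ver : dob -> dob -> Type;
  hid : forall X, hor X X;
  hseq : forall {X Y Z}, hor Y Z -> hor X Y -> hor X Z;
  vid : forall X, ver X X;
  vseq : forall {X Y Z}, ver Y Z -> ver X Y -> ver X Z;
  (* top, bottom, left and right edges *)
  cell : forall {X Y X' Y'}, hor X Y -> hor X' Y' -> ver X X' -> ver Y Y' -> Type;
  one_cell : forall {X Y} (f : hor X Y), cell f f (vid X) (vid Y);
  id_cell : forall {X X'} (u : ver X X'), cell (hid X) (hid X') u u;
  vpaste : forall {X Y X' Y' X'' Y''}
    {f : hor X Y} {g : hor X' Y'} {h : hor X'' Y''}
    {u : ver X X'} {v : ver Y Y'} {u' : ver X' X''} {v' : ver Y' Y''},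
    cell g h u' v' -> cell f g u v -> cell f h (vseq u' u) (vseq v' v);
  hpaste : forall {X Y Z X' Y' Z'}
    {g : hor Y Z} {g' : hor Y' Z'} {f : hor X Y} {f' : hor X' Y'}
    {u : ver X X'} {v : ver Y Y'} {w : ver Z Z'},
    cell g g' v w -> cell f f' u v -> cell (hseq g f) (hseq g' f') u w
}.

Arguments hor {_}.
Arguments ver {_}.
Arguments hid {_}.
Arguments vid {_}.

(** Equality of double cells includes equality of their four edges. *)
Record framed_cell (E : double_data) := FramedCell {
  fc_X : E; fc_Y : E; fc_X' : E; fc_Y' : E;
  fc_top : hor fc_X fc_Y; fc_bot : hor fc_X' fc_Y';
  fc_left : ver fc_X fc_X'; fc_right : ver fc_Y fc_Y';
  fc_cell : cell fc_top fc_bot fc_left fc_right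
}.

Definition cell_eq {E : double_data}
    {X Y X' Y' : E} {f : hor X Y} {f' : hor X' Y'} {u : ver X X'} {v : ver Y Y'}
    {Z T Z' T' : E} {g : hor Z T} {g' : hor Z' T'} {s : ver Z Z'} {t : ver T T'}
    (x : cell f f' u v) (y : cell g g' s t) : Prop :=
  FramedCell x = FramedCell y.

Notation "x ≡ y" := (cell_eq x y) (at level 70, no associativity) : bicat_scope.

Record double_laws (E : double_data) : Prop := DoubleLaws {
  hseqA : forall (X Y Z T : E) (h : hor Z T) (g : hor Y Z) (f : hor X Y),
    hseq h (hseq g f) = hseq (hseq h g) f;
  hseq1l : forall (X Y : E) (f : hor X Y), hseq (hid Y) f = f;
  hseq1r : forall (X Y : E) (f : hor X Y), hseq f (hid X) = f;
  vseqA : forall (X Y Z T : E) (w : ver Z T) (v : ver Y Z) (u : ver X Y),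
    vseq w (vseq v u) = vseq (vseq w v) u;
  vseq1l : forall (X Y : E) (u : ver X Y), vseq (vid Y) u = u;
  vseq1r : forall (X Y : E) (u : ver X Y), vseq u (vid X) = u;

  vpasteA : forall (X0 Y0 X1 Y1 X2 Y2 X3 Y3 : E)
    (f0 : hor X0 Y0) (f1 : hor X1 Y1) (f2 : hor X2 Y2) (f3 : hor X3 Y3)
    (u0 : ver X0 X1) (v0 : ver Y0 Y1) (u1 : ver X1 X2) (v1 : ver Y1 Y2)
    (u2 : ver X2 X3) (v2 : ver Y2 Y3)
    (z : cell f2 f3 u2 v2) (y : cell f1 f2 u1 v1) (x : cell f0 f1 u0 v0),
    vpaste z (vpaste y x) ≡ vpaste (vpaste z y) x;
  vpaste1l : forall (X Y X' Y' : E) (f : hor X Y) (g : hor X' Y')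
    (u : ver X X') (v : ver Y Y') (x : cell f g u v), vpaste (one_cell g) x ≡ x;
  vpaste1r : forall (X Y X' Y' : E) (f : hor X Y) (g : hor X' Y')
    (u : ver X X') (v : ver Y Y') (x : cell f g u v), vpaste x (one_cell f) ≡ x;

  hpasteA : forall (X Y Z T X' Y' Z' T' : E)
    (h : hor Z T) (g : hor Y Z) (f : hor X Y)
    (h' : hor Z' T') (g' : hor Y' Z') (f' : hor X' Y')
    (u : ver X X') (v : ver Y Y') (w : ver Z Z') (s : ver T T')
    (z : cell h h' w s) (y : cell g g' v w) (x : cell f f' u v),
    hpaste z (hpaste y x) ≡ hpaste (hpaste z y) x;
  hpaste1l : forall (X Y X' Y' : E) (f : hor X Y) (g : hor X' Y')
    (u : ver X X') (v : ver Y Y') (x : cell f g u v), hpaste (id_cell v) x ≡ x;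
  hpaste1r : forall (X Y X' Y' : E) (f : hor X Y) (g : hor X' Y')
    (u : ver X X') (v : ver Y Y') (x : cell f g u v), hpaste x (id_cell u) ≡ x;

  one_cell_hseq : forall (X Y Z : E) (g : hor Y Z) (f : hor X Y),
    one_cell (hseq g f) ≡ hpaste (one_cell g) (one_cell f);
  id_cell_vseq : forall (X Y Z : E) (v : ver Y Z) (u : ver X Y),
    id_cell (vseq v u) ≡ vpaste (id_cell v) (id_cell u);
  one_id_cell : forall X : E, one_cell (hid X) ≡ id_cell (vid X);
  paste_interchange : forall (X Y Z X' Y' Z' X'' Y'' Z'' : E)
    (g : hor Y Z) (g' : hor Y' Z') (g'' : hor Y'' Z'')
    (f : hor X Y) (f' : hor X' Y') (f'' : hor X'' Y'')
    (u : ver X X') (v : ver Y Y') (w : ver Z Z')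
    (u' : ver X' X'') (v' : ver Y' Y'') (w' : ver Z' Z'')
    (y' : cell g' g'' v' w') (y : cell g g' v w)
    (x' : cell f' f'' u' v') (x : cell f f' u v),
    hpaste (vpaste y' y) (vpaste x' x) ≡ vpaste (hpaste y' x') (hpaste y x)
}.

Record double_category := DoubleCategory {
  dc_data :> double_data;
  dc_laws : double_laws dc_data
}.

Record double_functor (E E' : double_category) := DoubleFunctor {
  df_ob :> E -> E';
  df_hor : forall {X Y : E}, hor X Y -> hor (df_ob X) (df_ob Y);
  df_ver : forall {X Y : E}, ver X Y -> ver (df_ob X) (df_ob Y);
  df_cell : forall {X Y X' Y' : E} {f : hor X Y} {g : hor X' Y'}
    {u : ver X X'} {v : ver Y Y'},
    cell f g u v -> cell (df_hor f) (df_hor g) (df_ver u) (df_ver v);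

  df_hid : forall X : E, df_hor (hid X) = hid (df_ob X);
  df_hseq : forall (X Y Z : E) (g : hor Y Z) (f : hor X Y),
    df_hor (hseq g f) = hseq (df_hor g) (df_hor f);
  df_vid : forall X : E, df_ver (vid X) = vid (df_ob X);
  df_vseq : forall (X Y Z : E) (v : ver Y Z) (u : ver X Y),
    df_ver (vseq v u) = vseq (df_ver v) (df_ver u);
  df_one_cell : forall (X Y : E) (f : hor X Y),
    df_cell (one_cell f) ≡ one_cell (df_hor f);
  df_id_cell : forall (X Y : E) (u : ver X Y),
    df_cell (id_cell u) ≡ id_cell (df_ver u);
  df_vpaste : forall (X Y X' Y' X'' Y'' : E)
    (f : hor X Y) (g : hor X' Y') (h : hor X'' Y'')
    (u : ver X X') (v : ver Y Y') (u' : ver X' X'') (v' : ver Y' Y'')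
    (y : cell g h u' v') (x : cell f g u v),
    df_cell (vpaste y x) ≡ vpaste (df_cell y) (df_cell x);
  df_hpaste : forall (X Y Z X' Y' Z' : E)
    (g : hor Y Z) (g' : hor Y' Z') (f : hor X Y) (f' : hor X' Y')
    (u : ver X X') (v : ver Y Y') (w : ver Z Z')
    (y : cell g g' v w) (x : cell f f' u v),
    df_cell (hpaste y x) ≡ hpaste (df_cell y) (df_cell x)
}.

Record vertical_transformation {E E' : double_category}
    (P Q : double_functor E E') := VerticalTransformation {
  vt_ver : forall X : E, ver (P X) (Q X);
  vt_cell : forall {X Y : E} (f : hor X Y),
    cell (df_hor P f) (df_hor Q f) (vt_ver X) (vt_ver Y);

  vt_ver_nat : forall (X Y : E) (u : ver X Y),
    vseq (df_ver Q u) (vt_ver X) = vseq (vt_ver Y) (df_ver P u);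
  vt_cell_nat : forall (X Y X' Y' : E) (f : hor X Y) (g : hor X' Y')
    (u : ver X X') (v : ver Y Y') (x : cell f g u v),
    vpaste (df_cell Q x) (vt_cell f) ≡ vpaste (vt_cell g) (df_cell P x);
  vt_hid : forall X : E, vt_cell (hid X) ≡ id_cell (vt_ver X);
  vt_hseq : forall (X Y Z : E) (g : hor Y Z) (f : hor X Y),
    vt_cell (hseq g f) ≡ hpaste (vt_cell g) (vt_cell f)
}.

Record companion {E : double_data} {X Y : E} (f : hor X Y) := Companion {
  cp_ver : ver X Y;
  cp_psi : cell (hid X) f (vid X) cp_ver;
  cp_chi : cell f (hid Y) cp_ver (vid Y);
  cp_hpaste : hpaste cp_chi cp_psi ≡ one_cell f;
  cp_vpaste : vpaste cp_chi cp_psi ≡ id_cell cp_ver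
}.

(** A horizontal arrow [vi_target] with a vertically invertible cell
    [vi_cell : h -> vi_target]. *)
Record vertical_iso {E : double_data} {X Y : E} (h : hor X Y) := VerticalIso {
  vi_X : E; vi_Y : E;
  vi_target : hor vi_X vi_Y;
  vi_left : ver X vi_X; vi_right : ver Y vi_Y;
  vi_left_inv : ver vi_X X; vi_right_inv : ver vi_Y Y;
  vi_cell : cell h vi_target vi_left vi_right;
  vi_inv : cell vi_target h vi_left_inv vi_right_inv;
  vi_cellK : vpaste vi_inv vi_cell ≡ one_cell h;
  vi_invK : vpaste vi_cell vi_inv ≡ one_cell vi_target
}.

(** The choice of [h'], [l], [phi^l], and of a companion of [h' ∘ l]. *)
Record left_choice {E : double_data} {X Y : E} (h : hor X Y) := LeftChoice {
  lc_iso : vertical_iso h;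
  lc_dom : E;
  lc_l : hor lc_dom (vi_X lc_iso);
  lc_comp : companion (hseq (vi_target lc_iso) lc_l)
}.

(** The choice of [h''], [r], [phi^r], and of a companion of [r ∘ h'']. *)
Record right_choice {E : double_data} {X Y : E} (h : hor X Y) := RightChoice {
  rc_iso : vertical_iso h;
  rc_cod : E;
  rc_r : hor (vi_Y rc_iso) rc_cod;
  rc_comp : companion (hseq rc_r (vi_target rc_iso))
}.

Definition conj_cell {E : double_data} {X Y X' Y' : E} {h : hor X Y} {k : hor X' Y'}
    {u : ver X X'} {v : ver Y Y'} (p : vertical_iso h) (q : vertical_iso k)
    (a : cell h k u v) :
    cell (vi_target p) (vi_target q)
      (vseq (vseq (vi_left q) u) (vi_left_inv p))
      (vseq (vseq (vi_right q) v) (vi_right_inv p)) :=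
  vpaste (vpaste (vi_cell q) a) (vi_inv p).

Definition left_W_condition {E : double_data} {X Y X' Y' : E}
    {h : hor X Y} {k : hor X' Y'} {u : ver X X'} {v : ver Y Y'}
    (a : cell h k u v) (p : left_choice h) (q : left_choice k) : Prop :=
  let a' := conj_cell (lc_iso p) (lc_iso q) a in
  exists (s : ver (lc_dom p) (lc_dom q))
         (al : cell (lc_l p) (lc_l q) s
                 (vseq (vseq (vi_left (lc_iso q)) u) (vi_left_inv (lc_iso p)))),
    vpaste (cp_chi (lc_comp q)) (hpaste a' al)
      ≡ vpaste
          (id_cell (vseq (vseq (vi_right (lc_iso q)) v) (vi_right_inv (lc_iso p))))
          (cp_chi (lc_comp p))
    /\
    vpaste (hpaste a' al) (cp_psi (lc_comp p))
      ≡ vpaste (cp_psi (lc_comp q)) (id_cell s).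

Definition right_W_condition {E : double_data} {X Y X' Y' : E}
    {h : hor X Y} {k : hor X' Y'} {u : ver X X'} {v : ver Y Y'}
    (a : cell h k u v) (p : right_choice h) (q : right_choice k) : Prop :=
  let a'' := conj_cell (rc_iso p) (rc_iso q) a in
  exists (t : ver (rc_cod p) (rc_cod q))
         (ar : cell (rc_r p) (rc_r q)
                 (vseq (vseq (vi_right (rc_iso q)) v) (vi_right_inv (rc_iso p))) t),
    vpaste (cp_chi (rc_comp q)) (hpaste ar a'')
      ≡ vpaste (id_cell t) (cp_chi (rc_comp p))
    /\
    vpaste (hpaste ar a'') (cp_psi (rc_comp p))
      ≡ vpaste (cp_psi (rc_comp q))
          (id_cell (vseq (vseq (vi_left (rc_iso q)) u) (vi_left_inv (rc_iso p)))).

Inductive path {B : bicat} : B -> B -> Type :=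
| pnil (a : B) : path a a
| pcons {a b c : B} : hom1 a b -> path b c -> path a c.

Fixpoint papp {B : bicat} {a b c : B} (p : path a b) : path b c -> path a c :=
  match p with
  | pnil _ => fun q => q
  | pcons f p' => fun q => pcons f (papp p' q)
  end.

(** Only nonempty paths have bracketings; the composite of the empty path is fixed to
    be the identity in [chosen]. *)
Inductive bracketing {B : bicat} : forall {a b : B}, path a b -> Type :=
| b_arr {a b : B} (f : hom1 a b) : bracketing (pcons f (pnil b))
| b_comp {a b c : B} {p : path a b} {q : path b c} :
    bracketing p -> bracketing q -> bracketing (papp p q).

Fixpoint b_eval {B : bicat} {a b : B} {p : path a b} (t : bracketing p) : hom1 a b :=
  match t in @bracketing _ a0 b0 _ return hom1 a0 b0 with
  | b_arr f => f
  | b_comp t1 t2 => b_eval t2 ∘ b_eval t1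
  end.

Definition bracketing_choice (B : bicat) : Type :=
  forall (a b c : B) (f : hom1 a b) (p : path b c), bracketing (pcons f p).

Definition chosen {B : bicat} (ch : bracketing_choice B) {a b : B} (p : path a b) :
    hom1 a b :=
  match p with
  | pnil a => id1 a
  | pcons f p' => b_eval (ch _ _ _ f p')
  end.

(** The canonical coherence cell between two bracketings of a path is obtained by
    passing through the reference composite [((1 ∘ f_n) ∘ f_(n-1)) ∘ ... ∘ f_1]. *)

Fixpoint ref_comp {B : bicat} {a b : B} (p : path a b) : hom1 a b :=
  match p with
  | pnil a => id1 a
  | pcons f p' => ref_comp p' ∘ f
  end.

Fixpoint ref_app {B : bicat} {a b c : B} (p : path a b) :
    forall q : path b c, ref_comp q ∘ ref_comp p ⇒ ref_comp (papp p q) :=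
  match p in path a0 b0
    return forall q : path b0 c, ref_comp q ∘ ref_comp p ⇒ ref_comp (papp p q)
  with
  | pnil a => fun q => runit (ref_comp q)
  | pcons f p' => fun q =>
      (ref_app p' q ⋆ id2 f) • assoc_inv (ref_comp q) (ref_comp p') f
  end.

Fixpoint ref_app_inv {B : bicat} {a b c : B} (p : path a b) :
    forall q : path b c, ref_comp (papp p q) ⇒ ref_comp q ∘ ref_comp p :=
  match p in path a0 b0
    return forall q : path b0 c, ref_comp (papp p q) ⇒ ref_comp q ∘ ref_comp p
  with
  | pnil a => fun q => runit_inv (ref_comp q)
  | pcons f p' => fun q =>
      assoc (ref_comp q) (ref_comp p') f • (ref_app_inv p' q ⋆ id2 f)
  end.

Fixpoint b_ref {B : bicat} {a b : B} {p : path a b} (t : bracketing p) :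
    b_eval t ⇒ ref_comp p :=
  match t in @bracketing _ a0 b0 p0 return b_eval t ⇒ ref_comp p0 with
  | b_arr f => lunit_inv f
  | @b_comp _ _ _ _ p q t1 t2 => ref_app p q • (b_ref t2 ⋆ b_ref t1)
  end.

Fixpoint b_ref_inv {B : bicat} {a b : B} {p : path a b} (t : bracketing p) :
    ref_comp p ⇒ b_eval t :=
  match t in @bracketing _ a0 b0 p0 return ref_comp p0 ⇒ b_eval t with
  | b_arr f => lunit f
  | @b_comp _ _ _ _ p q t1 t2 => (b_ref_inv t2 ⋆ b_ref_inv t1) • ref_app_inv p q
  end.

Definition to_ref {B : bicat} (ch : bracketing_choice B) {a b : B} (p : path a b) :
    chosen ch p ⇒ ref_comp p :=
  match p with
  | pnil a => id2 (id1 a)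
  | pcons f p' => b_ref (ch _ _ _ f p')
  end.

Definition of_ref {B : bicat} (ch : bracketing_choice B) {a b : B} (p : path a b) :
    ref_comp p ⇒ chosen ch p :=
  match p with
  | pnil a => id2 (id1 a)
  | pcons f p' => b_ref_inv (ch _ _ _ f p')
  end.

Definition split_chosen {B : bicat} (ch : bracketing_choice B) {a b c : B}
    (p : path a b) (q : path b c) :
    chosen ch (papp p q) ⇒ chosen ch q ∘ chosen ch p :=
  (of_ref ch q ⋆ of_ref ch p) • ref_app_inv p q • to_ref ch (papp p q).

Definition merge_chosen {B : bicat} (ch : bracketing_choice B) {a b c : B}
    (p : path a b) (q : path b c) :
    chosen ch q ∘ chosen ch p ⇒ chosen ch (papp p q) :=
  of_ref ch (papp p q) • ref_app p q • (to_ref ch q ⋆ to_ref ch p).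

(** A path with a marked index is given by its marked object and the parts of the
    path before and after the mark. *)

Record marked_path (B : bicat) := MarkedPath {
  mark : B;
  before : {s : B & path s mark};
  after : {t : B & path mark t}
}.

Definition app_before {B : bicat} {a b : B} (x : {s : B & path s a}) (p : path a b) :
    {s : B & path s b} :=
  existT _ (projT1 x) (papp (projT2 x) p).

Definition app_after {B : bicat} {a b : B} (p : path a b) (y : {t : B & path b t}) :
    {t : B & path a t} :=
  existT _ (projT1 y) (papp p (projT2 y)).

(** A path marked at [i0 <= i1] whose domain (mark [i0]) is [X] and whose codomain
    (mark [i1]) is [Y] is given by its segment between the marks. *)
Record doubly_marked {B : bicat} (X Y : marked_path B) := DoublyMarked {
  seg : path (mark X) (mark Y);
  seg_before : app_before (before X) seg = before Y;
  seg_after : app_after seg (after Y) = after X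
}.

Lemma doubly_marked_eq {B : bicat} {X Y : marked_path B} (f g : doubly_marked X Y) :
  seg f = seg g -> f = g.
Proof.
destruct f as [p b c], g as [q b' c']; simpl; intros <-.
now rewrite (proof_irrelevance _ b b'), (proof_irrelevance _ c c').
Qed.

Lemma papp_nil {B : bicat} {a b : B} (p : path a b) : papp p (pnil b) = p.
Proof. induction p; simpl; congruence. Qed.

Lemma papp_assoc {B : bicat} {a b c d : B}
    (p : path a b) (q : path b c) (r : path c d) :
  papp (papp p q) r = papp p (papp q r).
Proof. induction p as [|a a' b f p IH]; simpl; [easy|now rewrite IH]. Qed.

Definition dm_id {B : bicat} (X : marked_path B) : doubly_marked X X.
Proof.
refine (@DoublyMarked _ X X (pnil (mark X)) _ _).
- destruct X as [m [s p] y]; unfold app_before; simpl; now rewrite papp_nil.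
- now destruct X as [m x [t q]].
Defined.

Definition dm_seq {B : bicat} {X Y Z : marked_path B}
    (g : doubly_marked Y Z) (f : doubly_marked X Y) : doubly_marked X Z.
Proof.
refine (@DoublyMarked _ X Z (papp (seg f) (seg g)) _ _).
- rewrite <- (seg_before g), <- (seg_before f); unfold app_before; simpl.
  now rewrite papp_assoc.
- rewrite <- (seg_after f), <- (seg_after g); unfold app_after; simpl.
  now rewrite papp_assoc.
Defined.

Definition Dbl_data (B : bicat) (ch : bracketing_choice B) : double_data :=
  @DoubleData (marked_path B) (@doubly_marked B)
    (fun X Y => mark X = mark Y)
    (@dm_id B) (@dm_seq B)
    (fun X => eq_refl) (fun X Y Z v u => eq_trans u v)
    (fun X Y X' Y' f g u v => hom2_over u v (chosen ch (seg f)) (chosen ch (seg g)))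
    (fun X Y f => id2 (chosen ch (seg f)))
    (fun X X' u => id_over u)
    (fun X Y X' Y' X'' Y'' f g h u v u' v' y x => vcomp_over y x)
    (fun X Y Z X' Y' Z' g g' f f' u v w y x =>
       conj_over (merge_chosen ch (seg f') (seg g')) (hcomp_over y x)
         (split_chosen ch (seg f) (seg g))).

Fixpoint pmap {B D : bicat} (F : homomorphism B D) {a b : B} (p : path a b) :
    path (F a) (F b) :=
  match p in path a0 b0 return path (F a0) (F b0) with
  | pnil a => pnil (F a)
  | pcons f p' => pcons (h_1 F f) (pmap F p')
  end.

Fixpoint ref_map {B D : bicat} (F : homomorphism B D) {a b : B} (p : path a b) :
    ref_comp (pmap F p) ⇒ h_1 F (ref_comp p) :=
  match p in path a0 b0 return ref_comp (pmap F p) ⇒ h_1 F (ref_comp p) with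
  | pnil a => h_unit F a
  | pcons f p' => h_comp F (ref_comp p') f • (ref_map F p' ⋆ id2 (h_1 F f))
  end.

Fixpoint ref_map_inv {B D : bicat} (F : homomorphism B D) {a b : B} (p : path a b) :
    h_1 F (ref_comp p) ⇒ ref_comp (pmap F p) :=
  match p in path a0 b0 return h_1 F (ref_comp p) ⇒ ref_comp (pmap F p) with
  | pnil a => h_unit_inv F a
  | pcons f p' => (ref_map_inv F p' ⋆ id2 (h_1 F f)) • h_comp_inv F (ref_comp p') f
  end.

Definition coh {B D : bicat} (chB : bracketing_choice B) (chD : bracketing_choice D)
    (F : homomorphism B D) {a b : B} (p : path a b) :
    chosen chD (pmap F p) ⇒ h_1 F (chosen chB p) :=
  h_2 F (of_ref chB p) • ref_map F p • to_ref chD (pmap F p).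

Definition coh_inv {B D : bicat} (chB : bracketing_choice B)
    (chD : bracketing_choice D) (F : homomorphism B D) {a b : B} (p : path a b) :
    h_1 F (chosen chB p) ⇒ chosen chD (pmap F p) :=
  of_ref chD (pmap F p) • ref_map_inv F p • h_2 F (to_ref chB p).

Definition h_2_over {B D : bicat} (F : homomorphism B D) {a a' b b' : B}
    {u : a = a'} {v : b = b'} {f : hom1 a b} {g : hom1 a' b'} :
    hom2_over u v f g ->
    hom2_over (f_equal F u) (f_equal F v) (h_1 F f) (h_1 F g) :=
  match u as u0 in _ = x, v as v0 in _ = y
    return forall g : hom1 x y, hom2_over u0 v0 f g ->
      hom2_over (f_equal F u0) (f_equal F v0) (h_1 F f) (h_1 F g)
  with
  | eq_refl, eq_refl => fun g x => h_2 F x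
  end g.

Definition mp_map {B D : bicat} (F : homomorphism B D) (X : marked_path B) :
    marked_path D :=
  @MarkedPath D (F (mark X))
    (existT (fun s => path s (F (mark X))) (F (projT1 (before X)))
       (pmap F (projT2 (before X))))
    (existT (fun t => path (F (mark X)) t) (F (projT1 (after X)))
       (pmap F (projT2 (after X)))).

Lemma pmap_papp {B D : bicat} (F : homomorphism B D) {a b c : B}
    (p : path a b) (q : path b c) :
  pmap F (papp p q) = papp (pmap F p) (pmap F q).
Proof. induction p as [|a a' b f p IH]; simpl; [easy|now rewrite IH]. Qed.

Definition dm_map {B D : bicat} (F : homomorphism B D) {X Y : marked_path B}
    (f : doubly_marked X Y) : doubly_marked (mp_map F X) (mp_map F Y).
Proof.
refine (@DoublyMarked _ (mp_map F X) (mp_map F Y) (pmap F (seg f)) _ _);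
  unfold app_before, app_after, mp_map; simpl.
- rewrite <- (seg_before f); simpl; now rewrite pmap_papp.
- rewrite <- (seg_after f); simpl; now rewrite pmap_papp.
Defined.

(** The composite of the components of an icon along a path, between the reference
    composites; [icon_path] is the one between the chosen composites. *)
Fixpoint icon_ref {B D : bicat} {F G : homomorphism B D} (psi : icon F G) {a b : B}
    (p : path a b) :
    hom2_over (ic_ob psi a) (ic_ob psi b)
      (ref_comp (pmap F p)) (ref_comp (pmap G p)) :=
  match p in path a0 b0
    return hom2_over (ic_ob psi a0) (ic_ob psi b0)
             (ref_comp (pmap F p)) (ref_comp (pmap G p))
  with
  | pnil a => id_over (ic_ob psi a)
  | pcons f p' => hcomp_over (icon_ref psi p') (ic_1 psi f)
  end.

Definition icon_path {B D : bicat} (chD : bracketing_choice D)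
    {F G : homomorphism B D} (psi : icon F G) {a b : B} (p : path a b) :
    hom2_over (ic_ob psi a) (ic_ob psi b)
      (chosen chD (pmap F p)) (chosen chD (pmap G p)) :=
  conj_over (of_ref chD (pmap G p)) (icon_ref psi p) (to_ref chD (pmap F p)).

Lemma vc2 {B : bicat} {a b : B} {f g g' h : hom1 a b} {y : g ⇒ h} {x : f ⇒ g}
    {y' : g' ⇒ h} {x' : f ⇒ g'} (E : y • x = y' • x') {e : hom1 a b} (t : e ⇒ f) :
  y • (x • t) = y' • (x' • t).
Proof. now rewrite !vcompA, E. Qed.

Lemma vc1 {B : bicat} {a b : B} {f g h : hom1 a b} {y : g ⇒ h} {x : f ⇒ g}
    {w : f ⇒ h} (E : y • x = w) {e : hom1 a b} (t : e ⇒ f) :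
  y • (x • t) = w • t.
Proof. now rewrite vcompA, E. Qed.

Lemma vcK {B : bicat} {a b : B} {f g : hom1 a b} {y : g ⇒ f} {x : f ⇒ g}
    (E : y • x = id2 f) {e : hom1 a b} (t : e ⇒ f) :
  y • (x • t) = t.
Proof. now rewrite vcompA, E, vcomp1l. Qed.

Lemma cancel_l {B : bicat} {a b : B} {f g h : hom1 a b} {x : g ⇒ h} (y : h ⇒ g)
    {s t : f ⇒ g} : y • x = id2 g -> x • s = x • t -> s = t.
Proof. intros K E. now rewrite <- (vcomp1l s), <- (vcomp1l t), <- K, <- !vcompA, E. Qed.

Lemma cancel_r {B : bicat} {a b : B} {f g h : hom1 a b} {x : f ⇒ g} (y : g ⇒ f)
    {s t : g ⇒ h} : x • y = id2 g -> s • x = t • x -> s = t.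
Proof. intros K E. now rewrite <- (vcomp1r s), <- (vcomp1r t), <- K, !vcompA, E. Qed.

Lemma hcomp_l {B : bicat} {a b c : B} {g g' g'' : hom1 b c} (f : hom1 a b)
    (y : g' ⇒ g'') (x : g ⇒ g') :
  (y • x) ⋆ id2 f = (y ⋆ id2 f) • (x ⋆ id2 f).
Proof. now rewrite <- interchange, vcomp1l. Qed.

Lemma hcomp_r {B : bicat} {a b c : B} (g : hom1 b c) {f f' f'' : hom1 a b}
    (y : f' ⇒ f'') (x : f ⇒ f') :
  id2 g ⋆ (y • x) = (id2 g ⋆ y) • (id2 g ⋆ x).
Proof. now rewrite <- interchange, vcomp1l. Qed.

Lemma hcompK {B : bicat} {a b c : B} {g g' : hom1 b c} {f f' : hom1 a b}
    {y' : g' ⇒ g} {y : g ⇒ g'} {x' : f' ⇒ f} {x : f ⇒ f'} :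
  y' • y = id2 g -> x' • x = id2 f -> (y' ⋆ x') • (y ⋆ x) = id2 (g ∘ f).
Proof. intros E E'. now rewrite <- interchange, E, E', hcomp1. Qed.

Lemma whisker_exch {B : bicat} {a b c : B} {g g' : hom1 b c} {f f' : hom1 a b}
    (y : g ⇒ g') (x : f ⇒ f') :
  (id2 g' ⋆ x) • (y ⋆ id2 f) = (y ⋆ id2 f') • (id2 g ⋆ x).
Proof. now rewrite <- !interchange, !vcomp1l, !vcomp1r. Qed.

Lemma id_whisker_l_inj {B : bicat} {a b : B} {f g : hom1 a b} {x y : f ⇒ g} :
  id2 (id1 b) ⋆ x = id2 (id1 b) ⋆ y -> x = y.
Proof.
intros E. apply (cancel_r (lunitVK f)).
now rewrite <- !lunit_nat, E.
Qed.

Lemma id_whisker_r_inj {B : bicat} {a b : B} {f g : hom1 a b} {x y : f ⇒ g} :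
  x ⋆ id2 (id1 a) = y ⋆ id2 (id1 a) -> x = y.
Proof.
intros E. apply (cancel_r (runitVK f)).
now rewrite <- !runit_nat, E.
Qed.

Lemma lunit_comp {B : bicat} {a b c : B} (g : hom1 b c) (f : hom1 a b) :
  lunit (g ∘ f) • assoc (id1 c) g f = lunit g ⋆ id2 f.
Proof.
apply id_whisker_l_inj.
assert (K : (assoc (id1 c) (id1 c ∘ g) f • (assoc (id1 c) (id1 c) g ⋆ id2 f))
  • ((assoc_inv (id1 c) (id1 c) g ⋆ id2 f) • assoc_inv (id1 c) (id1 c ∘ g) f)
  = id2 _).
{ rewrite <- vcompA, (vcK (hcompK (assocVK _ _ _) (vcomp1l (id2 f)))).
  apply assocVK. }
apply (cancel_r K).
rewrite hcomp_r, <- vcompA, <- pentagon, vcompA, triangle.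
rewrite (vcompA (id2 (id1 c) ⋆ (lunit g ⋆ id2 f))), <- assoc_nat, <- vcompA.
rewrite <- hcomp_l, triangle.
rewrite assoc_nat, hcomp1.
reflexivity.
Qed.

Lemma runit_comp {B : bicat} {a b c : B} (g : hom1 b c) (f : hom1 a b) :
  (id2 g ⋆ runit f) • assoc g f (id1 a) = runit (g ∘ f).
Proof.
apply id_whisker_r_inj.
rewrite hcomp_l.
apply (cancel_l (assocK g f (id1 a))).
rewrite vcompA, assoc_nat, <- vcompA, <- triangle, hcomp_r, <- vcompA, <- pentagon.
rewrite vcompA, <- assoc_nat, hcomp1, <- vcompA, triangle.
reflexivity.
Qed.

Lemma lunit_runit_id {B : bicat} (a : B) : lunit (id1 a) = runit (id1 a).
Proof.
apply id_whisker_r_inj.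
rewrite <- triangle, <- lunit_comp.
f_equal.
apply (cancel_l (lunitK (id1 a))).
now rewrite lunit_nat.
Qed.

Lemma ref_appK {B : bicat} {a b c : B} (p : path a b) (q : path b c) :
  ref_app_inv p q • ref_app p q = id2 _.
Proof.
induction p as [a|a b' b f p IH]; simpl; [apply runitK|].
rewrite <- vcompA, (vcK (hcompK (IH q) (vcomp1l _))). apply assocVK.
Qed.

Lemma ref_app_invK {B : bicat} {a b c : B} (p : path a b) (q : path b c) :
  ref_app p q • ref_app_inv p q = id2 _.
Proof.
induction p as [a|a b' b f p IH]; simpl; [apply runitVK|].
rewrite <- vcompA, (vcK (assocK _ _ _)).
apply (hcompK (IH q) (vcomp1l _)).
Qed.

Lemma b_refK {B : bicat} {a b : B} {p : path a b} (t : bracketing p) :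
  b_ref_inv t • b_ref t = id2 _.
Proof.
induction t as [a b f|a b c p q t1 IH1 t2 IH2]; simpl; [apply lunitVK|].
rewrite <- vcompA, (vcK (ref_appK _ _)). now apply hcompK.
Qed.

Lemma b_ref_invK {B : bicat} {a b : B} {p : path a b} (t : bracketing p) :
  b_ref t • b_ref_inv t = id2 _.
Proof.
induction t as [a b f|a b c p q t1 IH1 t2 IH2]; simpl; [apply lunitK|].
rewrite <- vcompA, (vcK (hcompK IH2 IH1)). apply ref_app_invK.
Qed.

Lemma to_refK {B : bicat} (ch : bracketing_choice B) {a b : B} (p : path a b) :
  of_ref ch p • to_ref ch p = id2 _.
Proof. destruct p as [a|a b c f p]; simpl; [apply vcomp1l|exact (b_refK (ch _ _ _ f p))]. Qed.

Lemma of_refK {B : bicat} (ch : bracketing_choice B) {a b : B} (p : path a b) :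
  to_ref ch p • of_ref ch p = id2 _.
Proof. destruct p as [a|a b c f p]; simpl; [apply vcomp1l|exact (b_ref_invK (ch _ _ _ f p))]. Qed.

Definition ref_cast {B : bicat} {a b : B} {p q : path a b} (e : p = q) :
    ref_comp p ⇒ ref_comp q :=
  match e with eq_refl => id2 _ end.

Lemma ref_cast_cons {B : bicat} {a b c : B} (f : hom1 a b) {p q : path b c}
    (e : p = q) (e' : pcons f p = pcons f q) :
  ref_cast e' = ref_cast e ⋆ id2 f.
Proof.
destruct e. rewrite (proof_irrelevance _ e' eq_refl); simpl. now rewrite hcomp1.
Qed.

Lemma assoc_inv_nat {B : bicat} {a b c d : B}
    {h h' : hom1 c d} {g g' : hom1 b c} {f f' : hom1 a b}
    (z : h ⇒ h') (y : g ⇒ g') (x : f ⇒ f') :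
  assoc_inv h' g' f' • (z ⋆ (y ⋆ x)) = ((z ⋆ y) ⋆ x) • assoc_inv h g f.
Proof.
apply (cancel_l (assocK h' g' f')).
rewrite vcompA, assocVK, vcomp1l, vcompA, assoc_nat.
now rewrite <- vcompA, assocVK, vcomp1r.
Qed.

Lemma pentagon_inv {B : bicat} {a b c d e : B}
    (k : hom1 d e) (h : hom1 c d) (g : hom1 b c) (f : hom1 a b) :
  assoc_inv k (h ∘ g) f • ((id2 k ⋆ assoc_inv h g f) • assoc k h (g ∘ f))
  = (assoc k h g ⋆ id2 f) • assoc_inv (k ∘ h) g f.
Proof.
apply (cancel_r (assocVK (k ∘ h) g f)).
rewrite <- !vcompA, assocK, vcomp1r, pentagon.
rewrite (vcK (hcompK (vcomp1l _) (assocK _ _ _))).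
now rewrite (vcK (assocK _ _ _)).
Qed.

Lemma ref_app_assoc {B : bicat} {a b c d : B}
    (p : path a b) (q : path b c) (r : path c d)
    (e : papp (papp p q) r = papp p (papp q r)) :
  ref_cast e • (ref_app (papp p q) r • ((id2 _ ⋆ ref_app p q) • assoc _ _ _))
  = ref_app p (papp q r) • (ref_app q r ⋆ id2 _).
Proof.
revert q r e; induction p as [a|a b' b f p IH]; intros q r e; simpl in *.
- rewrite (proof_irrelevance _ e eq_refl); simpl.
  now rewrite vcomp1l, runit_nat, runit_comp.
- rewrite (ref_cast_cons (papp_assoc p q r) e).
  specialize (IH q r (papp_assoc p q r)).
  rewrite hcomp_r, <- !vcompA.
  rewrite (vc2 (assoc_inv_nat (id2 (ref_comp r)) (ref_app p q) (id2 f))).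
  rewrite pentagon_inv.
  rewrite <- (hcomp1 (ref_comp p) f), assoc_inv_nat.
  rewrite !vcompA, <- !hcomp_l. do 2 f_equal.
  now rewrite <- !vcompA.
Qed.

Lemma ref_app_nil {B : bicat} {a b : B} (p : path a b) (e : papp p (pnil b) = p) :
  ref_cast e • ref_app p (pnil b) = lunit (ref_comp p).
Proof.
revert e; induction p as [a|a b' b f p IH]; intros e; simpl in *.
- rewrite (proof_irrelevance _ e eq_refl); simpl.
  now rewrite vcomp1l, lunit_runit_id.
- rewrite (ref_cast_cons (papp_nil p) e), vcompA, <- hcomp_l, IH, <- lunit_comp.
  now rewrite <- vcompA, assocVK, vcomp1r.
Qed.

Definition norm {B : bicat} (ch : bracketing_choice B) {a b : B} {p q : path a b}
    (x : chosen ch p ⇒ chosen ch q) : ref_comp p ⇒ ref_comp q :=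
  to_ref ch q • (x • of_ref ch p).

Lemma norm_inj {B : bicat} (ch : bracketing_choice B) {a b : B} {p q : path a b}
    (x y : chosen ch p ⇒ chosen ch q) : norm x = norm y -> x = y.
Proof.
intros E. apply (cancel_r (to_refK ch p)), (cancel_l (to_refK ch q)). exact E.
Qed.

Lemma norm_id {B : bicat} (ch : bracketing_choice B) {a b : B} (p : path a b) :
  norm (id2 (chosen ch p)) = id2 _.
Proof. unfold norm. now rewrite vcomp1l, of_refK. Qed.

Lemma norm_vcomp {B : bicat} (ch : bracketing_choice B) {a b : B}
    {p q r : path a b} (y : chosen ch q ⇒ chosen ch r) (x : chosen ch p ⇒ chosen ch q) :
  norm (y • x) = norm y • norm x.
Proof. unfold norm. now rewrite <- !vcompA, (vcK (to_refK ch q)). Qed.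

Lemma norm_hcomp {B : bicat} (ch : bracketing_choice B) {a b c : B}
    {p p' : path a b} {q q' : path b c}
    (y : chosen ch q ⇒ chosen ch q') (x : chosen ch p ⇒ chosen ch p') :
  norm (p := papp p q) (q := papp p' q') (merge_chosen ch p' q' • (y ⋆ x) • split_chosen ch p q)
  = ref_app p' q' • ((norm y ⋆ norm x) • ref_app_inv p q).
Proof.
unfold norm, merge_chosen, split_chosen.
rewrite <- !vcompA, of_refK, vcomp1r, (vcK (of_refK _ _)).
now rewrite !interchange, <- !vcompA.
Qed.

Lemma Dbl_cell_eq {B : bicat} (ch : bracketing_choice B) {m n : B}
    {bX aX bY aY bX' aX' bY' aY'}
    (f f' : doubly_marked (@MarkedPath B m bX aX) (@MarkedPath B n bY aY))
    (g g' : doubly_marked (@MarkedPath B m bX' aX') (@MarkedPath B n bY' aY'))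
    (x : chosen ch (seg f) ⇒ chosen ch (seg g))
    (x' : chosen ch (seg f') ⇒ chosen ch (seg g'))
    (ef : seg f = seg f') (eg : seg g = seg g') :
  ref_cast eg • norm x = norm x' • ref_cast ef ->
  @cell_eq (Dbl_data ch) _ _ _ _ f g eq_refl eq_refl _ _ _ _ f' g' eq_refl eq_refl x x'.
Proof.
intros E.
assert (f = f') by now apply doubly_marked_eq.
assert (g = g') by now apply doubly_marked_eq.
subst f' g'.
rewrite (proof_irrelevance _ ef eq_refl), (proof_irrelevance _ eg eq_refl) in E.
simpl in E. rewrite vcomp1l, vcomp1r in E.
now rewrite (norm_inj E).
Qed.

Definition hcomp_chosen {B : bicat} (ch : bracketing_choice B) {a b c : B}
    {p p' : path a b} {q q' : path b c}
    (y : chosen ch q ⇒ chosen ch q') (x : chosen ch p ⇒ chosen ch p') :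
    chosen ch (papp p q) ⇒ chosen ch (papp p' q') :=
  merge_chosen ch p' q' • (y ⋆ x) • split_chosen ch p q.

Lemma norm_hcompA {B : bicat} (ch : bracketing_choice B) {a b c d : B}
    {p p' : path a b} {q q' : path b c} {r r' : path c d}
    (z : chosen ch r ⇒ chosen ch r') (y : chosen ch q ⇒ chosen ch q')
    (x : chosen ch p ⇒ chosen ch p') :
  ref_cast (papp_assoc p' q' r') • norm (hcomp_chosen z (hcomp_chosen y x))
  = norm (hcomp_chosen (hcomp_chosen z y) x) • ref_cast (papp_assoc p q r).
Proof.
unfold hcomp_chosen; rewrite !norm_hcomp.
assert (K : (ref_app (papp p q) r • ((id2 _ ⋆ ref_app p q) • assoc _ _ _))
  • (assoc_inv _ _ _ • ((id2 _ ⋆ ref_app_inv p q) • ref_app_inv (papp p q) r))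
  = id2 _).
{ rewrite <- !vcompA, (vcK (assocVK _ _ _)).
  rewrite (vcK (hcompK (vcomp1l _) (ref_app_invK _ _))). apply ref_app_invK. }
apply (cancel_r K). clear K.
rewrite <- !vcompA, ref_app_assoc.
rewrite (vcK (ref_appK (papp p q) r)), (vcK (ref_appK p (papp q r))).
rewrite (vc1 (eq_sym (interchange _ _ _ _))), <- interchange, !vcomp1r.
rewrite <- !vcompA, !ref_appK, !vcomp1r.
assert (E1 : norm z ⋆ (ref_app p' q' • (norm y ⋆ norm x))
  = (id2 _ ⋆ ref_app p' q') • (norm z ⋆ (norm y ⋆ norm x)))
  by now rewrite <- interchange, vcomp1l.
assert (E2 : (ref_app q' r' • (norm z ⋆ norm y)) ⋆ norm x
  = (ref_app q' r' ⋆ id2 _) • ((norm z ⋆ norm y) ⋆ norm x))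
  by now rewrite <- interchange, vcomp1l.
rewrite E1, E2, <- vcompA, <- assoc_nat.
pose proof (ref_app_assoc (papp_assoc p' q' r')) as E.
now rewrite (vcompA (ref_app p' _)), <- E, <- !vcompA.
Qed.

Lemma norm_hcomp1l {B : bicat} (ch : bracketing_choice B) {a b : B}
    {p p' : path a b} (x : chosen ch p ⇒ chosen ch p') :
  ref_cast (papp_nil p')
    • norm (hcomp_chosen (q := pnil b) (q' := pnil b) (id2 (chosen ch (pnil b))) x)
  = norm x • ref_cast (papp_nil p).
Proof.
unfold hcomp_chosen; rewrite norm_hcomp.
rewrite (norm_id ch (pnil b)), vcompA, ref_app_nil, vcompA.
simpl ref_comp. rewrite lunit_nat, <- (ref_app_nil (papp_nil p)).
now rewrite <- !vcompA, ref_app_invK, vcomp1r.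
Qed.

Lemma norm_hcomp1r {B : bicat} (ch : bracketing_choice B) {a b : B}
    {p p' : path a b} (x : chosen ch p ⇒ chosen ch p') :
  norm (hcomp_chosen (p := pnil a) (p' := pnil a) x (id2 (chosen ch (pnil a)))) = norm x.
Proof.
unfold hcomp_chosen; rewrite norm_hcomp, (norm_id ch (pnil a)); simpl.
now rewrite vcompA, runit_nat, <- vcompA, runitVK, vcomp1r.
Qed.

Lemma hcomp_chosen1 {B : bicat} (ch : bracketing_choice B) {a b c : B}
    (p : path a b) (q : path b c) :
  hcomp_chosen (id2 (chosen ch q)) (id2 (chosen ch p)) = id2 (chosen ch (papp p q)).
Proof.
apply norm_inj. unfold hcomp_chosen.
now rewrite norm_hcomp, !norm_id, hcomp1, vcomp1l, ref_app_invK.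
Qed.

Lemma hcomp_chosen_interchange {B : bicat} (ch : bracketing_choice B) {a b c : B}
    {p p' p'' : path a b} {q q' q'' : path b c}
    (y' : chosen ch q' ⇒ chosen ch q'') (y : chosen ch q ⇒ chosen ch q')
    (x' : chosen ch p' ⇒ chosen ch p'') (x : chosen ch p ⇒ chosen ch p') :
  hcomp_chosen (y' • y) (x' • x) = hcomp_chosen y' x' • hcomp_chosen y x.
Proof.
apply norm_inj. rewrite norm_vcomp. unfold hcomp_chosen.
rewrite !norm_hcomp, !norm_vcomp.
now rewrite interchange, <- !vcompA, (vcK (ref_appK _ _)).
Qed.

Ltac open_marked :=
  simpl in *;
  repeat match goal with X : marked_path _ |- _ => destruct X as [? ? ?] end;
  simpl in *;
  repeat match goal with u : _ = _ |- _ => destruct u end.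

Ltac by_norm :=
  open_marked; unshelve eapply Dbl_cell_eq; [reflexivity..|]; simpl;
  rewrite ?vcomp1l, ?vcomp1r.

Lemma Dbl_double_laws (B : bicat) (ch : bracketing_choice B) :
  double_laws (Dbl_data ch).
Proof.
constructor; intros.
- apply doubly_marked_eq; simpl. apply papp_assoc.
- apply doubly_marked_eq; simpl. apply papp_nil.
- now apply doubly_marked_eq.
- exact (proof_irrelevance (mark _ = mark _) _ _).
- exact (proof_irrelevance (mark _ = mark _) _ _).
- exact (proof_irrelevance (mark _ = mark _) _ _).
- by_norm. now rewrite vcompA.
- now by_norm.
- now by_norm.
- open_marked. unshelve eapply Dbl_cell_eq; [apply papp_assoc..|].
  exact (norm_hcompA z y x).
- open_marked. unshelve eapply Dbl_cell_eq; [apply papp_nil..|].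
  exact (norm_hcomp1l x).
- by_norm. exact (norm_hcomp1r x).
- by_norm. f_equal. symmetry. exact (hcomp_chosen1 ch (seg f) (seg g)).
- now by_norm.
- reflexivity.
- by_norm. f_equal. exact (hcomp_chosen_interchange y' y x' x).
Qed.

Definition Dbl (B : bicat) (ch : bracketing_choice B) : double_category :=
  DoubleCategory (Dbl_double_laws ch).

Lemma ref_mapK {B D : bicat} (F : homomorphism B D) {a b : B} (p : path a b) :
  ref_map_inv F p • ref_map F p = id2 _.
Proof.
induction p as [a|a b' b f p IH]; simpl; [apply (h_unitK F)|].
rewrite <- vcompA, (vcK (proj1 (h_compK F _ _))). now apply hcompK; [|apply vcomp1l].
Qed.

Lemma ref_map_invK {B D : bicat} (F : homomorphism B D) {a b : B} (p : path a b) :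
  ref_map F p • ref_map_inv F p = id2 _.
Proof.
induction p as [a|a b' b f p IH]; simpl; [apply (h_unitK F)|].
rewrite <- vcompA, (vcK (hcompK IH (vcomp1l _))). apply (h_compK F).
Qed.

Lemma h_assoc_inv {B D : bicat} (F : homomorphism B D) {a b c d : B}
    (h : hom1 c d) (g : hom1 b c) (f : hom1 a b) :
  h_2 F (assoc_inv h g f) • (h_comp F h (g ∘ f) • (id2 (h_1 F h) ⋆ h_comp F g f))
  = h_comp F (h ∘ g) f
      • ((h_comp F h g ⋆ id2 (h_1 F f)) • assoc_inv (h_1 F h) (h_1 F g) (h_1 F f)).
Proof.
apply (cancel_r (assocVK (h_1 F h) (h_1 F g) (h_1 F f))).
rewrite <- !vcompA, assocK, vcomp1r.
rewrite (vcompA (h_comp F h (g ∘ f))), <- h_assoc.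
now rewrite !vcompA, <- h_vcomp, assocK, h_id2, vcomp1l.
Qed.

Lemma ref_map_app {B D : bicat} (F : homomorphism B D) {a b c : B}
    (p : path a b) (q : path b c)
    (e : papp (pmap F p) (pmap F q) = pmap F (papp p q)) :
  ref_map F (papp p q) • (ref_cast e • ref_app (pmap F p) (pmap F q))
  = h_2 F (ref_app p q)
      • (h_comp F (ref_comp q) (ref_comp p) • (ref_map F q ⋆ ref_map F p)).
Proof.
revert q e; induction p as [a|a b' b f p IH]; intros q e; simpl in *.
- rewrite (proof_irrelevance _ e eq_refl); simpl; rewrite vcomp1l.
  rewrite <- (runit_nat (ref_map F q)), <- h_runit, <- !vcompA.
  now rewrite <- interchange, vcomp1l, vcomp1r.
- specialize (IH q (eq_sym (pmap_papp F p q))).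
  rewrite (ref_cast_cons (eq_sym (pmap_papp F p q)) e).
  rewrite !vcompA, <- (vcompA _ (ref_map F (papp p q) ⋆ _)), <- hcomp_l.
  rewrite <- (vcompA _ _ (ref_app (pmap F p) (pmap F q) ⋆ _)), <- hcomp_l.
  rewrite <- (vcompA (ref_map F (papp p q))), IH.
  rewrite h_vcomp.
  assert (E : ref_map F q ⋆ (h_comp F (ref_comp p) f • (ref_map F p ⋆ id2 (h_1 F f)))
    = (id2 _ ⋆ h_comp F (ref_comp p) f)
        • (ref_map F q ⋆ (ref_map F p ⋆ id2 (h_1 F f))))
    by now rewrite <- interchange, vcomp1l.
  rewrite E, <- !vcompA, (vcompA (h_comp F (ref_comp q) _)),
    (vcompA (h_2 F (assoc_inv _ _ _))), h_assoc_inv, <- !vcompA, assoc_inv_nat.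
  assert (E2 : h_2 F (ref_app p q ⋆ id2 f) • h_comp F (ref_comp q ∘ ref_comp p) f
    = h_comp F _ f • (h_2 F (ref_app p q) ⋆ id2 (h_1 F f)))
    by now rewrite <- h_comp_nat, h_id2.
  now rewrite (vc2 E2), !hcomp_l, <- !vcompA.
Qed.

Definition dcell_map {B D : bicat} (chB : bracketing_choice B)
    (chD : bracketing_choice D) (F : homomorphism B D) {a a' b b' : B}
    {u : a = a'} {v : b = b'} {p : path a b} {q : path a' b'}
    (x : hom2_over u v (chosen chB p) (chosen chB q)) :
    hom2_over (f_equal F u) (f_equal F v)
      (chosen chD (pmap F p)) (chosen chD (pmap F q)) :=
  conj_over (coh_inv chB chD F q) (h_2_over F x) (coh chB chD F p).

Definition cell_map {B D : bicat} (chB : bracketing_choice B)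
    (chD : bracketing_choice D) (F : homomorphism B D) {a b : B} {p q : path a b}
    (x : chosen chB p ⇒ chosen chB q) :
    chosen chD (pmap F p) ⇒ chosen chD (pmap F q) :=
  coh_inv chB chD F q • h_2 F x • coh chB chD F p.

Lemma norm_cell_map {B D : bicat} (chB : bracketing_choice B)
    (chD : bracketing_choice D) (F : homomorphism B D) {a b : B} {p q : path a b}
    (x : chosen chB p ⇒ chosen chB q) :
  norm (cell_map chD F x)
  = ref_map_inv F q • (h_2 F (norm x) • ref_map F p).
Proof.
unfold norm, cell_map, coh, coh_inv.
rewrite <- !vcompA, of_refK, vcomp1r, (vcK (of_refK _ _)).
now rewrite !h_vcomp, <- !vcompA.
Qed.

Lemma cell_map1 {B D : bicat} (chB : bracketing_choice B)
    (chD : bracketing_choice D) (F : homomorphism B D) {a b : B} (p : path a b) :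
  cell_map chD F (id2 (chosen chB p))
  = id2 (chosen chD (pmap F p)).
Proof.
apply (norm_inj (ch := chD) (p := pmap F p) (q := pmap F p)).
now rewrite norm_cell_map, !norm_id, h_id2, vcomp1l, ref_mapK.
Qed.

Lemma cell_map_vcomp {B D : bicat} (chB : bracketing_choice B)
    (chD : bracketing_choice D) (F : homomorphism B D) {a b : B} {p q r : path a b}
    (y : chosen chB q ⇒ chosen chB r) (x : chosen chB p ⇒ chosen chB q) :
  cell_map chD F (y • x)
  = (cell_map chD F y)
    • cell_map chD F x.
Proof.
apply (norm_inj (ch := chD) (p := pmap F p) (q := pmap F r)).
rewrite norm_vcomp, !norm_cell_map, norm_vcomp, h_vcomp.
now rewrite <- !vcompA, (vcK (ref_map_invK F q)).
Qed.

Lemma ref_castK {B : bicat} {a b : B} {p q : path a b} (e : p = q) (e' : q = p) :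
  ref_cast e • ref_cast e' = id2 _.
Proof. destruct e; rewrite (proof_irrelevance _ e' eq_refl); apply vcomp1l. Qed.

Lemma norm_cell_map_hcomp {B D : bicat} (chB : bracketing_choice B)
    (chD : bracketing_choice D) (F : homomorphism B D) {a b c : B}
    {p p' : path a b} {q q' : path b c}
    (y : chosen chB q ⇒ chosen chB q') (x : chosen chB p ⇒ chosen chB p') :
  ref_cast (pmap_papp F p' q')
    • norm (cell_map chD F (hcomp_chosen y x))
  = norm (hcomp_chosen
            (cell_map chD F y)
            (cell_map chD F x))
      • ref_cast (pmap_papp F p q).
Proof.
unfold hcomp_chosen at 2; rewrite norm_hcomp, !norm_cell_map.
unfold hcomp_chosen; rewrite norm_hcomp.
set (e := pmap_papp F p q). set (e' := pmap_papp F p' q').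
assert (K : (ref_cast (eq_sym e) • ref_app (pmap F p) (pmap F q))
  • (ref_app_inv (pmap F p) (pmap F q) • ref_cast e) = id2 _)
  by now rewrite <- vcompA, (vcK (ref_app_invK _ _)), ref_castK.
apply (cancel_r K); clear K.
assert (L : (ref_map F (papp p' q') • (ref_cast (eq_sym e')
              • ref_app (pmap F p') (pmap F q')))
  • ((ref_app_inv (pmap F p') (pmap F q') • ref_cast e') • ref_map_inv F (papp p' q'))
   = id2 _).
{ rewrite <- !vcompA, (vcK (ref_app_invK _ _)), (vcK (ref_castK _ _)).
  apply ref_map_invK. }
assert (L' : (ref_map_inv F (papp p' q')
     • (ref_map F (papp p' q') • ref_cast (eq_sym e'))) • ref_cast e' = id2 _)
  by now rewrite (vcK (ref_mapK _ _)), ref_castK.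
apply (cancel_l (x := ref_map F (papp p' q') • ref_cast (eq_sym e'))
         (y := ref_cast e' • ref_map_inv F (papp p' q'))).
{ rewrite <- !vcompA, (vcK (ref_mapK _ _)). apply ref_castK. }
clear L L'.
rewrite <- !vcompA, (vcK (ref_castK (eq_sym e') e')), (vcK (ref_map_invK _ _)).
rewrite ref_map_app, (vcK (ref_castK e (eq_sym e))), ref_appK, vcomp1r.
rewrite (vcompA (ref_cast (eq_sym e'))), (vcompA (ref_map F (papp p' q'))).
rewrite ref_map_app, <- !vcompA, <- interchange.
rewrite (vcK (ref_map_invK F q')), (vcK (ref_map_invK F p')).
rewrite interchange, (vc2 (h_comp_nat F (norm y) (norm x))).
rewrite !vcompA, <- !h_vcomp, <- !vcompA, ref_appK, vcomp1r.
reflexivity.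
Qed.

Definition Dbl_functor {B D : bicat} (chB : bracketing_choice B)
    (chD : bracketing_choice D) (F : homomorphism B D) :
    double_functor (Dbl chB) (Dbl chD).
Proof.
refine (@DoubleFunctor (Dbl chB) (Dbl chD) (mp_map F)
  (fun X Y f => dm_map F f) (fun X Y u => f_equal F u)
  (fun X Y X' Y' f g u v x => dcell_map chD F x) _ _ _ _ _ _ _ _); intros.
- now apply doubly_marked_eq.
- apply doubly_marked_eq, pmap_papp.
- reflexivity.
- exact (proof_irrelevance (mark (mp_map F _) = mark (mp_map F _)) _ _).
- by_norm. f_equal. exact (cell_map1 chB chD F (seg f)).
- by_norm. f_equal. exact (cell_map1 chB chD F (pnil _)).
- by_norm. f_equal. exact (cell_map_vcomp chD F y x).
- open_marked. unshelve eapply Dbl_cell_eq; [apply pmap_papp..|].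
  exact (norm_cell_map_hcomp chD F y x).
Defined.

Ltac open_icon F G psi :=
  destruct F as [F0 F1 F2 Fc Fci Fu Fui ? ? ? ? ? ? ? ?],
           G as [G0 G1 G2 Gc Gci Gu Gui ? ? ? ? ? ? ? ?],
           psi as [e p1 pn pc pu]; simpl in *;
  assert (E0 : F0 = G0) by (apply functional_extensionality; exact e);
  subst G0;
  assert (E1 : e = fun a => eq_refl)
    by (apply functional_extensionality_dep; intros; apply proof_irrelevance);
  subst e; unfold hom2_over, conj_over in *; simpl in *.

Lemma icon_ref_app_step {D : bicat} {a b c d : D} {f f' : hom1 a b} {p p' : hom1 b c}
    {q q' : hom1 c d} {m m' n n' : hom1 b d}
    (r : q ⇒ q') (s : p ⇒ p') (y : f ⇒ f') (t : n ⇒ n')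
    (R : q ∘ p ⇒ m) (k : m ⇒ n) (R' : q' ∘ p' ⇒ m') (k' : m' ⇒ n') :
  id2 _ • t • (k • R) = k' • R' • (r ⋆ s) • id2 _ ->
  id2 _ • (t ⋆ y) • ((k ⋆ id2 f) • ((R ⋆ id2 f) • assoc_inv q p f))
  = (k' ⋆ id2 f') • ((R' ⋆ id2 f') • assoc_inv q' p' f') • (r ⋆ (s ⋆ y)) • id2 _.
Proof.
rewrite !vcomp1l, !vcomp1r; intros E.
rewrite <- !vcompA, assoc_inv_nat, !vcompA, <- !interchange, !vcomp1r.
now rewrite <- vcompA, E, !vcomp1l.
Qed.

Lemma icon_ref_app {B D : bicat} {F G : homomorphism B D} (psi : icon F G) {a b c : B}
    (p : path a b) (q : path b c)
    (e : papp (pmap F p) (pmap F q) = pmap F (papp p q))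
    (e' : papp (pmap G p) (pmap G q) = pmap G (papp p q)) :
  conj_over (id2 _) (icon_ref psi (papp p q))
    (ref_cast e • ref_app (pmap F p) (pmap F q))
  = conj_over (ref_cast e' • ref_app (pmap G p) (pmap G q))
      (hcomp_over (icon_ref psi q) (icon_ref psi p)) (id2 _).
Proof.
revert q e e'; induction p as [a|a b' b f p IH]; intros q e e'; simpl in *.
- rewrite (proof_irrelevance _ e eq_refl), (proof_irrelevance _ e' eq_refl).
  clear e e'. generalize (icon_ref psi q).
  open_icon F G psi. intros r. now rewrite !vcomp1l, vcomp1r, runit_nat.
- specialize (IH q (eq_sym (pmap_papp F p q)) (eq_sym (pmap_papp G p q))).
  rewrite (ref_cast_cons (eq_sym (pmap_papp F p q)) e).
  rewrite (ref_cast_cons (eq_sym (pmap_papp G p q)) e').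
  clear e e'. revert IH.
  generalize (eq_sym (pmap_papp F p q)) (eq_sym (pmap_papp G p q)).
  generalize (icon_ref psi q) (icon_ref psi p) (icon_ref psi (papp p q)).
  open_icon F G psi. intros r s t k k' IH.
  exact (icon_ref_app_step (p1 a b' f) IH).
Qed.

Lemma ref_map_icon_step {D : bicat} {a b c : D} {f f' : hom1 a b} {p p' q q' : hom1 b c}
    {n n' : hom1 a c} (y : f ⇒ f') (s : p ⇒ p') (t : q ⇒ q') (M : p ⇒ q) (M' : p' ⇒ q')
    (k : q ∘ f ⇒ n) (k' : q' ∘ f' ⇒ n') (z : n ⇒ n') :
  M' • s • id2 _ = id2 _ • t • M ->
  id2 _ • z • k = k' • (t ⋆ y) • id2 _ ->
  k' • (M' ⋆ id2 f') • (s ⋆ y) • id2 _ = id2 _ • z • (k • (M ⋆ id2 f)).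
Proof.
rewrite !vcomp1l, !vcomp1r; intros E E'.
rewrite vcompA, E', <- !vcompA, <- !interchange, E.
now rewrite vcomp1l, vcomp1r.
Qed.

Lemma ref_map_icon {B D : bicat} {F G : homomorphism B D} (psi : icon F G) {a b : B}
    (p : path a b) :
  conj_over (ref_map G p) (icon_ref psi p) (id2 _)
  = conj_over (id2 _) (ic_1 psi (ref_comp p)) (ref_map F p).
Proof.
induction p as [a|a b' b f p IH]; simpl.
- symmetry; apply ic_unit.
- revert IH. pose proof (ic_comp psi (ref_comp p) f) as E. revert E.
  generalize (icon_ref psi p) (ref_map F p) (ref_map G p).
  open_icon F G psi. intros s M M' E IH.
  exact (ref_map_icon_step IH E).
Qed.

Definition of_norm {B : bicat} (ch : bracketing_choice B) {a b : B} {p q : path a b}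
    (x : ref_comp p ⇒ ref_comp q) : chosen ch p ⇒ chosen ch q :=
  of_ref ch q • x • to_ref ch p.

Lemma norm_of_norm {B : bicat} (ch : bracketing_choice B) {a b : B} {p q : path a b}
    (x : ref_comp p ⇒ ref_comp q) :
  norm (of_norm ch x) = x.
Proof.
unfold norm, of_norm.
now rewrite <- !vcompA, of_refK, vcomp1r, (vcK (of_refK _ _)).
Qed.

Lemma norm_square {B : bicat} (ch : bracketing_choice B) {a b : B}
    {p p' q q' : path a b} {x : chosen ch p ⇒ chosen ch q}
    {x' : chosen ch p' ⇒ chosen ch q'} {r : ref_comp p ⇒ ref_comp p'}
    {s : ref_comp q ⇒ ref_comp q'} {w : ref_comp p ⇒ ref_comp q}
    {w' : ref_comp p' ⇒ ref_comp q'} :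
  norm x' = w' -> norm x = w -> w' • r = s • w ->
  norm (x' • of_norm ch r) = norm (of_norm ch s • x).
Proof. intros E E' E''. now rewrite !norm_vcomp, !norm_of_norm, E, E'. Qed.

Lemma icon_nat_step {D : bicat} {a b : D} {p p' q q' fp fp' fq fq' : hom1 a b}
    (r : p ⇒ p') (s : q ⇒ q') (M : p ⇒ fp) (M' : p' ⇒ fp') (N : q ⇒ fq) (N' : q' ⇒ fq')
    (Ni : fq ⇒ q) (Ni' : fq' ⇒ q') (x : fp ⇒ fq) (x' : fp' ⇒ fq')
    (k : fp ⇒ fp') (l : fq ⇒ fq') :
  Ni' • N' = id2 _ -> N • Ni = id2 _ ->
  M' • r • id2 _ = id2 _ • k • M -> N' • s • id2 _ = id2 _ • l • N ->
  id2 _ • l • x = x' • k • id2 _ ->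
  (Ni' • (x' • M')) • r = s • (Ni • (x • M)).
Proof.
rewrite !vcomp1l, !vcomp1r; intros K K' E1 E2 E3.
rewrite <- !vcompA, E1, (vc2 (eq_sym E3)).
rewrite <- (vcomp1l s), <- K, <- (vcompA Ni'), E2, <- !vcompA.
now rewrite (vcK K').
Qed.

Lemma icon_hseq_step {D : bicat} (ch : bracketing_choice D) {a b c : D}
    {p p' : path a b} {q q' : path b c} {m m' : path a c}
    (r : ref_comp q ⇒ ref_comp q') (s : ref_comp p ⇒ ref_comp p')
    (t : ref_comp m ⇒ ref_comp m') (e : m = papp p q) (e' : m' = papp p' q') :
  id2 _ • t • (ref_cast (eq_sym e) • ref_app p q)
  = ref_cast (eq_sym e') • ref_app p' q' • (r ⋆ s) • id2 _ ->
  ref_cast e' • norm (of_norm ch t)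
  = norm (hcomp_chosen (of_norm ch r) (of_norm ch s)) • ref_cast e.
Proof.
intros E. unfold hcomp_chosen; rewrite norm_hcomp, !norm_of_norm.
subst m m'; simpl in *.
rewrite !vcomp1l, !vcomp1r in E. rewrite vcomp1l, vcomp1r.
now rewrite vcompA, <- E, <- vcompA, ref_app_invK, vcomp1r.
Qed.

Definition Dbl_transformation {B D : bicat} (chB : bracketing_choice B)
    (chD : bracketing_choice D) {F G : homomorphism B D} (psi : icon F G) :
    vertical_transformation (Dbl_functor chB chD F) (Dbl_functor chB chD G).
Proof.
refine (@VerticalTransformation (Dbl chB) (Dbl chD)
  (Dbl_functor chB chD F) (Dbl_functor chB chD G)
  (fun X => ic_ob psi (mark X))
  (fun X Y f => icon_path chD psi (seg f)) _ _ _ _); intros.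
- exact (proof_irrelevance (mark (mp_map F _) = mark (mp_map G _)) _ _).
- open_marked. unfold icon_path.
  pose proof (ref_map_icon psi (seg f)) as Ef.
  pose proof (ref_map_icon psi (seg g)) as Eg.
  pose proof (ic_nat psi (norm x)) as Ex.
  pose proof (ref_mapK G (seg g)) as K.
  pose proof (ref_map_invK F (seg g)) as K'.
  open_icon F G psi.
  unshelve eapply Dbl_cell_eq; [reflexivity..|]; simpl.
  rewrite vcomp1l, vcomp1r.
  match type of K with ref_map_inv ?G' _ • _ = _ =>
  match type of K' with ref_map ?F' _ • _ = _ =>
    exact (norm_square (norm_cell_map chD G' x) (norm_cell_map chD F' x)
      (icon_nat_step K K' Ef Eg Ex))
  end end.
- open_marked. open_icon F G psi.
  unshelve eapply Dbl_cell_eq; [reflexivity..|]; simpl.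
  unfold icon_path, conj_over; simpl. now rewrite !vcomp1l, vcomp1r.
- open_marked. unfold icon_path.
  pose proof (icon_ref_app psi
    (eq_sym (pmap_papp F (seg f) (seg g))) (eq_sym (pmap_papp G (seg f) (seg g)))) as E.
  open_icon F G psi.
  match type of E with
  | _ • _ • (ref_cast (eq_sym ?eF) • _) = ref_cast (eq_sym ?eG) • _ • _ • _ =>
    unshelve eapply Dbl_cell_eq;
      [exact eF | exact eG | exact (icon_hseq_step chD E)]
  end.
Defined.

Definition W_doubly_marked {C : category} (W : arrow_class C)
    (ch : bracketing_choice (locally_discrete C))
    {X Y : Dbl ch} (w : hor X Y) : Prop :=
  W (mark X) (mark Y) (chosen ch (seg w)).

(** The notion does not depend on the auxiliary choices (for W-homomorphisms they
    exist), so the cells are required for all of them. *)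
Definition vertical_W_transformation {C : category} (W : arrow_class C)
    (ch : bracketing_choice (locally_discrete C)) {E : double_category}
    {P Q : double_functor (Dbl ch) E} (alpha : vertical_transformation P Q) : Prop :=
  forall (X Y : Dbl ch) (w : hor X Y), W_doubly_marked W w ->
    (forall (lP : left_choice (df_hor P w)) (lQ : left_choice (df_hor Q w)),
       left_W_condition (vt_cell alpha w) lP lQ) /\
    (forall (rP : right_choice (df_hor P w)) (rQ : right_choice (df_hor Q w)),
       right_W_condition (vt_cell alpha w) rP rQ).

(* Main.v *)
From Stdlib Require Import ProofIrrelevance.
Require Import Defs.

(** Call a 2-cell [t : f ⇒ g] between equivalences a W-cell if for all adjoint inverses
    of [f] and [g] it has a companion 2-cell between the inverses compatible with units
    and counits.  In [Dbl], a companion of [h' ∘ l] is exactly an isomorphism [h' ∘ l ≅ 1],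
    so the left condition asks for a 2-cell [l_P ⇒ l_Q] compatible with counits and the
    right condition for a 2-cell [r_P ⇒ r_Q] compatible with units.  Every isomorphism
    [f ∘ l ≅ 1] with [f] an equivalence is the counit of an adjoint equivalence, and
    dually for units, so W-cells satisfy both conditions.  Conversely, given adjoint
    inverses of [f] and [g], the two conditions yield a lift compatible with the counits
    and a lift compatible with the units; the triangle identities force them to be equal.
    Being a W-cell is invariant under isomorphism, hence passes between [psi_w] and the
    component of [Dbl psi] at a path with composite [w]. *)

Set Implicit Arguments.
Unset Strict Implicit.
Unset Printing Implicit Defensive.
Local Open Scope bicat_scope.

(** * Invertible 2-cells, isomorphic arrows and internal equivalences *)

Lemma inverse2_id {B : bicat} {a b : B} (f : hom1 a b) : inverse2 (id2 f) (id2 f).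
Proof. split; apply vcomp1l. Qed.

Lemma inverse2_sym {B : bicat} {a b : B} {f g : hom1 a b} {x : f ⇒ g} {y : g ⇒ f} :
  inverse2 x y -> inverse2 y x.
Proof. now intros [? ?]. Qed.

Lemma inverse2_vcomp {B : bicat} {a b : B} {f g h : hom1 a b}
    {y : g ⇒ h} {y' : h ⇒ g} {x : f ⇒ g} {x' : g ⇒ f} :
  inverse2 y y' -> inverse2 x x' -> inverse2 (y • x) (x' • y').
Proof.
intros [Hy Hy'] [Hx Hx']; split; rewrite <- vcompA.
- now rewrite (vcK Hy).
- now rewrite (vcK Hx').
Qed.

Lemma inverse2_hcomp {B : bicat} {a b c : B} {g g' : hom1 b c} {f f' : hom1 a b}
    {y : g ⇒ g'} {y' : g' ⇒ g} {x : f ⇒ f'} {x' : f' ⇒ f} :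
  inverse2 y y' -> inverse2 x x' -> inverse2 (y ⋆ x) (y' ⋆ x').
Proof. intros [Hy Hy'] [Hx Hx']; split; now apply hcompK. Qed.

Lemma inverse2_unique {B : bicat} {a b : B} {f g : hom1 a b} {x : f ⇒ g} {y z : g ⇒ f} :
  inverse2 x y -> inverse2 x z -> y = z.
Proof. intros [H H'] [K K']. apply (cancel_l H). congruence. Qed.

Definition inverse2_assoc {B : bicat} {a b c d : B}
    (h : hom1 c d) (g : hom1 b c) (f : hom1 a b) :
    inverse2 (assoc h g f) (assoc_inv h g f) :=
  conj (assocK h g f) (assocVK h g f).

Definition inverse2_lunit {B : bicat} {a b : B} (f : hom1 a b) :
    inverse2 (lunit f) (lunit_inv f) :=
  conj (lunitK f) (lunitVK f).

Definition inverse2_runit {B : bicat} {a b : B} (f : hom1 a b) :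
    inverse2 (runit f) (runit_inv f) :=
  conj (runitK f) (runitVK f).

Definition isomorphic2 {B : bicat} {a b : B} (f g : hom1 a b) : Prop :=
  exists (x : f ⇒ g) (y : g ⇒ f), inverse2 x y.

Lemma isomorphic2_sym {B : bicat} {a b : B} (f g : hom1 a b) :
  isomorphic2 f g -> isomorphic2 g f.
Proof. intros (x & y & H). exists y, x. now apply inverse2_sym. Qed.

Lemma isomorphic2_trans {B : bicat} {a b : B} (f g h : hom1 a b) :
  isomorphic2 f g -> isomorphic2 g h -> isomorphic2 f h.
Proof.
intros (x & x' & H) (y & y' & K). exists (y • x), (x' • y'). now apply inverse2_vcomp.
Qed.

Lemma isomorphic2_comp {B : bicat} {a b c : B} (g g' : hom1 b c) (f f' : hom1 a b) :
  isomorphic2 g g' -> isomorphic2 f f' -> isomorphic2 (g ∘ f) (g' ∘ f').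
Proof.
intros (y & y' & H) (x & x' & K). exists (y ⋆ x), (y' ⋆ x'). now apply inverse2_hcomp.
Qed.

Lemma isomorphic2_refl {B : bicat} {a b : B} (f : hom1 a b) : isomorphic2 f f.
Proof. exists (id2 f), (id2 f). apply inverse2_id. Qed.

Lemma isomorphic2_assoc {B : bicat} {a b c d : B}
    (h : hom1 c d) (g : hom1 b c) (f : hom1 a b) :
  isomorphic2 (h ∘ g ∘ f) (h ∘ (g ∘ f)).
Proof. exists (assoc h g f), (assoc_inv h g f). apply inverse2_assoc. Qed.

Lemma isomorphic2_lunit {B : bicat} {a b : B} (f : hom1 a b) :
  isomorphic2 (id1 b ∘ f) f.
Proof. exists (lunit f), (lunit_inv f). apply inverse2_lunit. Qed.

Lemma isomorphic2_runit {B : bicat} {a b : B} (f : hom1 a b) :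
  isomorphic2 (f ∘ id1 a) f.
Proof. exists (runit f), (runit_inv f). apply inverse2_runit. Qed.

Lemma internal_equivalence_of_isos {B : bicat} {a b : B} (f : hom1 a b) (g : hom1 b a) :
  isomorphic2 (g ∘ f) (id1 a) -> isomorphic2 (f ∘ g) (id1 b) -> internal_equivalence f.
Proof.
intros (x & x' & H) (y & y' & K).
exists g, x', x, y, y'. split; [now apply inverse2_sym|exact K].
Qed.

Lemma internal_equivalence_isos {B : bicat} {a b : B} (f : hom1 a b) :
  internal_equivalence f ->
  exists g, isomorphic2 (g ∘ f) (id1 a) /\ isomorphic2 (f ∘ g) (id1 b).
Proof.
intros (g & x & x' & y & y' & H & K). exists g.
split; [exists x', x; now apply inverse2_sym|now exists y, y'].
Qed.

Lemma internal_equivalence_iso {B : bicat} {a b : B} (f f' : hom1 a b) :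
  isomorphic2 f f' -> internal_equivalence f -> internal_equivalence f'.
Proof.
intros I E. destruct (internal_equivalence_isos E) as (g & H & K).
apply isomorphic2_sym in I.
apply (@internal_equivalence_of_isos _ _ _ f' g).
- apply isomorphic2_trans with (g ∘ f); auto using isomorphic2_comp, isomorphic2_refl.
- apply isomorphic2_trans with (f ∘ g); auto using isomorphic2_comp, isomorphic2_refl.
Qed.

(* A left inverse [r] of [f] is isomorphic to any inverse [g] of [f]. *)
Lemma left_inverse_equivalence {B : bicat} {a b : B} (f : hom1 a b) (r : hom1 b a) :
  internal_equivalence f -> isomorphic2 (r ∘ f) (id1 a) -> internal_equivalence r.
Proof.
intros E H. destruct (internal_equivalence_isos E) as (g & Hg & Kg).
apply (@internal_equivalence_iso _ _ _ g); [|now apply internal_equivalence_of_isos with f].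
apply isomorphic2_sym.
apply isomorphic2_trans with (r ∘ id1 b); [apply isomorphic2_sym, isomorphic2_runit|].
apply isomorphic2_trans with (r ∘ (f ∘ g)).
{ apply isomorphic2_comp; [apply isomorphic2_refl|now apply isomorphic2_sym]. }
apply isomorphic2_trans with (r ∘ f ∘ g); [apply isomorphic2_sym, isomorphic2_assoc|].
apply isomorphic2_trans with (id1 a ∘ g); [|apply isomorphic2_lunit].
apply isomorphic2_comp; [exact H|apply isomorphic2_refl].
Qed.

(** * Whiskering with an equivalence is fully faithful on 2-cells *)

Lemma lunit_inv_nat {B : bicat} {a b : B} {f f' : hom1 a b} (x : f ⇒ f') :
  lunit_inv f' • x = (id2 (id1 b) ⋆ x) • lunit_inv f.
Proof.
apply (cancel_l (lunitK f')).
now rewrite vcompA, lunitVK, vcomp1l, vcompA, lunit_nat, <- vcompA, lunitVK, vcomp1r.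
Qed.

(** Naturality in [y] of the cell y ⇒ g ∘ (f ∘ y) induced by [e]. When [e] is invertible,
    conjugation by this cell recovers [z] from its whiskering with [f]. *)
Lemma whisker_unit_nat {B : bicat} {a b c : B} {f : hom1 a b} {g : hom1 b a}
    (e : id1 a ⇒ g ∘ f) {x y : hom1 c a} (z : x ⇒ y) :
  assoc g f y • (e ⋆ id2 y) • lunit_inv y • z
  = (id2 g ⋆ (id2 f ⋆ z)) • (assoc g f x • (e ⋆ id2 x) • lunit_inv x).
Proof.
rewrite <- !vcompA, lunit_inv_nat.
rewrite (vc1 (eq_sym (interchange _ _ _ _))), vcomp1l, vcomp1r.
rewrite (vc2 (eq_sym (assoc_nat _ _ _))), hcomp1.
rewrite (vc1 (eq_sym (interchange _ _ _ _))), vcomp1l, vcomp1r.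
reflexivity.
Qed.

Lemma whisker_unit_inverse {B : bicat} {a b c : B} {f : hom1 a b} {g : hom1 b a}
    {e : id1 a ⇒ g ∘ f} {e'} (H : inverse2 e e') (y : hom1 c a) :
  inverse2 (assoc g f y • (e ⋆ id2 y) • lunit_inv y)
           (lunit y • ((e' ⋆ id2 y) • assoc_inv g f y)).
Proof.
apply inverse2_vcomp; [|apply inverse2_sym, inverse2_lunit].
apply inverse2_vcomp; [apply inverse2_assoc|].
apply inverse2_hcomp; [exact H|apply inverse2_id].
Qed.

Lemma whisker_faithful {B : bicat} {a b c : B} {f : hom1 a b} {g : hom1 b a}
    {e : id1 a ⇒ g ∘ f} {e'} (H : inverse2 e e') {x y : hom1 c a} (z z' : x ⇒ y) :
  id2 f ⋆ z = id2 f ⋆ z' -> z = z'.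
Proof.
intros E. apply (cancel_l (proj1 (whisker_unit_inverse H y))).
now rewrite !whisker_unit_nat, E.
Qed.

Lemma whisker_full {B : bicat} {a b c : B} {f : hom1 a b} :
  internal_equivalence f ->
  forall {x y : hom1 c a} (z : f ∘ x ⇒ f ∘ y), exists z' : x ⇒ y, id2 f ⋆ z' = z.
Proof.
intros (g & e & e' & k & k' & He & Hk) x y z.
destruct (whisker_unit_inverse He x) as [Kx Kx'].
destruct (whisker_unit_inverse He y) as [Ky Ky'].
pose proof (@whisker_unit_nat _ _ _ c f g e x y) as N. revert Kx Kx' Ky Ky' N.
generalize (assoc g f x • (e ⋆ id2 x) • lunit_inv x)
  (lunit x • ((e' ⋆ id2 x) • assoc_inv g f x))
  (assoc g f y • (e ⋆ id2 y) • lunit_inv y)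
  (lunit y • ((e' ⋆ id2 y) • assoc_inv g f y)).
intros u u' v v' Kx Kx' Ky Ky' N.
(* The preimage is [id2 g ⋆ z] conjugated by the unit isomorphisms. Since f ∘ g ≅ 1, whiskering with
   [g] is faithful as well, and after whiskering the claim is an instance of naturality. *)
exists (v' • ((id2 g ⋆ z) • u)).
apply (whisker_faithful (inverse2_sym Hk)).
apply (cancel_r Kx').
rewrite <- N. now rewrite vcompA, Ky', vcomp1l.
Qed.

(** * Coherence identities and completion to adjoint equivalences *)

Lemma triangle_inv {B : bicat} {a b c : B} (g : hom1 b c) (f : hom1 a b) :
  assoc_inv g (id1 b) f • (id2 g ⋆ lunit_inv f) = runit_inv g ⋆ id2 f.
Proof.
apply (cancel_l (x := runit g ⋆ id2 f) (y := runit_inv g ⋆ id2 f)).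
{ apply hcompK; [apply runitK|apply vcomp1l]. }
rewrite (hcompK (runitVK g) (vcomp1l _)), <- triangle.
rewrite <- vcompA, (vcK (assocVK _ _ _)).
now rewrite <- interchange, vcomp1l, lunitVK, hcomp1.
Qed.

Lemma lunit_comp_inv {B : bicat} {a b c : B} (g : hom1 b c) (f : hom1 a b) :
  lunit (g ∘ f) = (lunit g ⋆ id2 f) • assoc_inv (id1 c) g f.
Proof. now rewrite <- lunit_comp, <- vcompA, assocVK, vcomp1r. Qed.

Lemma runit_comp_inv {B : bicat} {a b c : B} (g : hom1 b c) (f : hom1 a b) :
  id2 g ⋆ runit f = runit (g ∘ f) • assoc_inv g f (id1 a).
Proof. now rewrite <- runit_comp, <- vcompA, assocVK, vcomp1r. Qed.

Lemma pentagon_inv_whisker {B : bicat} {a b c d e : B}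
    (k : hom1 d e) (h : hom1 c d) (g : hom1 b c) (f : hom1 a b) :
  assoc_inv (k ∘ h) g f • (assoc_inv k h (g ∘ f) • (id2 k ⋆ assoc h g f))
  = (assoc_inv k h g ⋆ id2 f) • assoc_inv k (h ∘ g) f.
Proof.
apply (cancel_l (x := assoc k h g ⋆ id2 f) (y := assoc_inv k h g ⋆ id2 f)).
{ apply hcompK; [apply assocK|apply vcomp1l]. }
rewrite (vcK (hcompK (assocVK k h g) (vcomp1l (id2 f)))).
rewrite vcompA, <- pentagon_inv, <- !vcompA.
rewrite (vcK (assocVK k h (g ∘ f))), <- interchange, vcomp1l, assocK, hcomp1.
apply vcomp1r.
Qed.

(** Naturality of the unitors turns each side into [k ⋆ k] followed by a unitor at the identity
    arrow, where the left and right unitors coincide. *)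
Lemma unit_counit_exchange {B : bicat} {b : B} {x : hom1 b b} (k : x ⇒ id1 b) :
  k • (runit x • (id2 x ⋆ k)) = k • (lunit x • (k ⋆ id2 x)).
Proof.
rewrite (vcompA k), <- runit_nat, (vcompA k (lunit x)), <- lunit_nat.
rewrite <- !vcompA, <- !interchange, !vcomp1l, !vcomp1r.
now rewrite lunit_runit_id.
Qed.

(* Whiskering with [f] is faithful, and after whiskering the second triangle composite
   is absorbed by the counit because of the first. *)
Lemma triangle_star_of_triangle_f {B : bicat} {a b : B} {f : hom1 a b} {l : hom1 b a}
    (e : id1 a ⇒ l ∘ f) {k : f ∘ l ⇒ id1 b} {k' : id1 b ⇒ f ∘ l} :
  internal_equivalence f -> inverse2 k k' ->
  lunit f • (k ⋆ id2 f) • assoc_inv f l f • (id2 f ⋆ e) • runit_inv f = id2 f ->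
  runit l • (id2 l ⋆ k) • assoc l f l • (e ⋆ id2 l) • lunit_inv l = id2 l.
Proof.
intros (g & u & u' & v & v' & Hu & Hv) Hk T.
apply (whisker_faithful Hu). apply (cancel_l (proj1 Hk)).
rewrite hcomp1, vcomp1r, !hcomp_r, runit_comp_inv, <- !vcompA.
rewrite (vc2 (assoc_inv_nat (id2 f) (id2 l) k)), hcomp1.
rewrite (vcompA (runit (f ∘ l))), (vcompA k), unit_counit_exchange.
rewrite lunit_comp_inv, <- !vcompA, <- (hcomp1 f l).
rewrite (vc2 (assoc_inv_nat k (id2 f) (id2 l))).
rewrite (vcompA (assoc_inv f l (f ∘ l))), (vcompA (assoc_inv (f ∘ l) f l)).
rewrite pentagon_inv_whisker, <- !vcompA.
rewrite (vc2 (assoc_inv_nat (id2 f) e (id2 l))), triangle_inv.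
rewrite <- !hcomp_l, !vcompA, T.
now rewrite hcomp1, vcomp1r.
Qed.

(** The given [k] is kept and the unit is built to fit it: whiskering with [f] is full, which
    produces [e] and [e'], and faithful, which makes them inverse to each other. *)
Lemma adjoint_completion {B : bicat} {a b : B} {f : hom1 a b} {l : hom1 b a}
    {k : f ∘ l ⇒ id1 b} {k' : id1 b ⇒ f ∘ l} :
  internal_equivalence f -> inverse2 k k' ->
  exists (e : id1 a ⇒ l ∘ f) (e' : l ∘ f ⇒ id1 a),
    inverse2 e e' /\
    lunit f • (k ⋆ id2 f) • assoc_inv f l f • (id2 f ⋆ e) • runit_inv f = id2 f /\
    runit l • (id2 l ⋆ k) • assoc l f l • (e ⋆ id2 l) • lunit_inv l = id2 l.
Proof.
intros Hf Hk.
(* Solving the first triangle identity for [id2 f ⋆ e] leaves [z] as its only possible value. *)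
set (z := assoc f l f • ((k' ⋆ id2 f) • (lunit_inv f • runit f))).
set (z' := runit_inv f • lunit f • (k ⋆ id2 f) • assoc_inv f l f).
assert (Hz : inverse2 z z').
{ apply inverse2_vcomp; [apply inverse2_assoc|].
  apply inverse2_vcomp; [apply inverse2_hcomp|];
    [now apply inverse2_sym|apply inverse2_id|].
  apply inverse2_vcomp; [apply inverse2_sym, inverse2_lunit|apply inverse2_runit]. }
destruct (whisker_full Hf z) as [e He].
destruct (whisker_full Hf z') as [e' He'].
assert (T : lunit f • (k ⋆ id2 f) • assoc_inv f l f • (id2 f ⋆ e) • runit_inv f = id2 f).
{ rewrite He. unfold z. rewrite <- !vcompA, (vcK (assocK _ _ _)).
  rewrite (vcK (hcompK (proj2 Hk) (vcomp1l _))).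
  now rewrite runitVK, vcomp1r, lunitVK. }
exists e, e'. split; [|split; [exact T|exact (triangle_star_of_triangle_f Hf Hk T)]].
destruct Hf as (g & u & u' & v & v' & Hu & Hv), Hz as [Hz Hz'].
split; apply (whisker_faithful Hu);
  now rewrite hcomp_r, He, He', hcomp1.
Qed.

Lemma inverse2_id_eq {B : bicat} {a b : B} {f : hom1 a b} {x y : f ⇒ f} :
  inverse2 x y -> x = id2 f -> y = id2 f.
Proof. intros H E. rewrite E in H. exact (inverse2_unique H (inverse2_id f)). Qed.

Lemma inverse2_eq {B : bicat} {a b : B} {f g : hom1 a b} {x : f ⇒ g} {y z : g ⇒ f} :
  inverse2 x y -> y = z -> inverse2 x z.
Proof. now intros H <-. Qed.

(** Each triangle composite of the flipped data is inverse to the other triangle composite of [P],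
    hence an identity. The flip transfers completion of counits to completion of units. *)
Definition pseudo_inverse_flip {B : bicat} {a b : B} {f : hom1 a b}
    (P : pseudo_inverse f) : pseudo_inverse (star P).
Proof.
refine (@PseudoInverse _ _ _ (star P) f (eps_inv P) (eps P) (eta_inv P) (eta P)
  (inverse2_sym (eps_inverse P)) (inverse2_sym (eta_inverse P)) _ _);
  [refine (inverse2_id_eq _ (triangle_star P))|refine (inverse2_id_eq _ (triangle_f P))];
  (eapply inverse2_eq; [repeat eapply inverse2_vcomp|]);
  try first [apply inverse2_assoc|apply inverse2_lunit|apply inverse2_runit
    |apply inverse2_sym, inverse2_assoc|apply inverse2_sym, inverse2_lunit
    |apply inverse2_sym, inverse2_runit
    |eapply inverse2_hcomp; apply inverse2_id || apply eta_inverse || apply eps_inverse];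
  now rewrite <- !vcompA.
Defined.

(* The conclusion is stated through a predicate because [eta P] and [e] have the same
   type only after identifying [star P] with [r]. *)
Lemma pseudo_inverse_of_unit {B : bicat} {a b : B} {f : hom1 a b} {r : hom1 b a}
    {e : id1 a ⇒ r ∘ f} {e' : r ∘ f ⇒ id1 a} :
  internal_equivalence f -> inverse2 e e' ->
  forall Q : (forall r : hom1 b a, id1 a ⇒ r ∘ f -> r ∘ f ⇒ id1 a -> Prop),
   (forall P : pseudo_inverse f, Q (star P) (eta P) (eta_inv P)) -> Q r e e'.
Proof.
intros Hf He Q HQ.
assert (Hr : internal_equivalence r)
  by (apply (left_inverse_equivalence Hf); now exists e', e; apply inverse2_sym).
(* The inverse [e'] of the unit serves as a counit for [r]; completing [r] and flipping the result
   gives an adjoint inverse of [f] with unit [e]. *)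
destruct (adjoint_completion Hr (inverse2_sym He)) as (n & n' & H & T & T').
exact (HQ (pseudo_inverse_flip (PseudoInverse H (inverse2_sym He) T T'))).
Qed.

Lemma pseudo_inverse_of_counit {B : bicat} {a b : B} {f : hom1 a b} {l : hom1 b a}
    {k : f ∘ l ⇒ id1 b} {k' : id1 b ⇒ f ∘ l} :
  internal_equivalence f -> inverse2 k k' ->
  forall Q : (forall l : hom1 b a, f ∘ l ⇒ id1 b -> id1 b ⇒ f ∘ l -> Prop),
   (forall P : pseudo_inverse f, Q (star P) (eps P) (eps_inv P)) -> Q l k k'.
Proof.
intros Hf Hk. destruct (adjoint_completion Hf Hk) as (e & e' & H & T & T').
intros Q HQ. exact (HQ (PseudoInverse H Hk T T')).
Qed.

(** * W-cells, and lifts between adjoint inverses *)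

(** [W_icon psi] is, definitionally, [W_cell (ic_1 psi w)] for all [w] in [W]. *)
Definition W_cell {B : bicat} {a a' b b' : B} {u : a = a'} {v : b = b'}
    {f : hom1 a b} {g : hom1 a' b'} (t : hom2_over u v f g) : Prop :=
  forall (P : pseudo_inverse f) (Q : pseudo_inverse g),
  exists s : hom2_over v u (star P) (star Q),
    conj_over (eta_inv Q) (hcomp_over s t) (eta P) = id_over u /\
    conj_over (eps Q) (hcomp_over t s) (eps_inv P) = id_over v.

Definition counit_lift {B : bicat} {a b : B} {f g : hom1 a b} (t : f ⇒ g)
    {l m : hom1 b a} (k : f ∘ l ⇒ id1 b) (k' : g ∘ m ⇒ id1 b) : Prop :=
  exists s : l ⇒ m, k' • (t ⋆ s) = k.

Definition unit_lift {B : bicat} {a b : B} {f g : hom1 a b} (t : f ⇒ g)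
    {l m : hom1 b a} (e : id1 a ⇒ l ∘ f) (e' : id1 a ⇒ m ∘ g) : Prop :=
  exists s : l ⇒ m, (s ⋆ t) • e = e'.

(** Insert the triangle identity of [Q] after [s]. The equation for [s'] replaces [eta Q] by
    [eta P], the one for [s] replaces [eps Q] by [eps P], and [s'] then slides out in front of the
    triangle identity of [P]. *)
Lemma lifts_agree {B : bicat} {a b : B} {f g : hom1 a b} (t : f ⇒ g)
    (P : pseudo_inverse f) (Q : pseudo_inverse g) (s s' : star P ⇒ star Q) :
  eps Q • (t ⋆ s) = eps P -> (s' ⋆ t) • eta P = eta Q -> s = s'.
Proof.
intros Hs Hs'.
rewrite <- (vcomp1l s), <- (triangle_star Q), <- !vcompA, lunit_inv_nat.
rewrite (vc1 (eq_sym (interchange _ _ _ _))), vcomp1l, vcomp1r, <- Hs'.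
assert (E : ((s' ⋆ t) • eta P) ⋆ s = ((s' ⋆ t) ⋆ s) • (eta P ⋆ id2 (star P)))
  by now rewrite <- interchange, vcomp1r.
rewrite E, <- !vcompA, (vc2 (assoc_nat s' t s)).
rewrite (vc1 (eq_sym (interchange _ _ _ _))), vcomp1l, Hs.
assert (E' : s' ⋆ eps P = (s' ⋆ id2 _) • (id2 (star P) ⋆ eps P))
  by now rewrite <- interchange, vcomp1l, vcomp1r.
rewrite E', <- !vcompA, (vc2 (runit_nat s')).
now rewrite !vcompA, <- (vcompA s'), <- (vcompA s'), <- (vcompA s'), <- (vcompA s'),
  triangle_star, vcomp1r.
Qed.

Lemma adjoint_lift {B : bicat} {a b : B} {f g : hom1 a b} {t : f ⇒ g}
    {P : pseudo_inverse f} {Q : pseudo_inverse g} {s s' : star P ⇒ star Q} :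
  eps Q • (t ⋆ s) = eps P -> (s' ⋆ t) • eta P = eta Q ->
  eta_inv Q • (s ⋆ t) • eta P = id2 _ /\ eps Q • (t ⋆ s) • eps_inv P = id2 _.
Proof.
intros E E'. split.
- rewrite (lifts_agree E E'), <- vcompA, E'. apply eta_inverse.
- rewrite E. apply eps_inverse.
Qed.

(** * Equality of double cells, and companions in [Dbl] *)

(** A framed cell is sent to a dependent pair over the tuple of its edges. Here the two tuples are
    the same, so proof irrelevance yields equality of the second components. *)
Lemma cell_eq_inj {E : double_data} {X Y X' Y' : E} {f : hor X Y} {f' : hor X' Y'}
    {u : ver X X'} {v : ver Y Y'} {x y : cell f f' u v} : x ≡ y -> x = y.
Proof.
intros H.
apply (f_equal (fun c : framed_cell E =>
  existT (fun d : {X : E & {Y : E & {X' : E & {Y' : E &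
      (hor X Y * hor X' Y' * ver X X' * ver Y Y')%type}}}} =>
    let '(existT _ X (existT _ Y (existT _ X' (existT _ Y' (f, f', u, v))))) := d in
    cell f f' u v)
  (existT _ (fc_X c) (existT _ (fc_Y c) (existT _ (fc_X' c) (existT _ (fc_Y' c)
    (fc_top c, fc_bot c, fc_left c, fc_right c)))))
  (fc_cell c))) in H.
exact (ProofIrrelevanceTheory.EqdepTheory.inj_pair2 _ _ _ _ _ H).
Qed.

Lemma cell_eq_of_eq {E : double_data} {X Y X' Y' : E} {f : hor X Y} {f' : hor X' Y'}
    {u : ver X X'} {v : ver Y Y'} {x y : cell f f' u v} : x = y -> x ≡ y.
Proof. now intros <-. Qed.

(** Converse of [Dbl_cell_eq]. It extracts an equation of 2-cells when the edges agree only up to a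
    provable equality of paths, such as [papp_nil]. *)
Lemma Dbl_cell_eq_inv {B : bicat} (ch : bracketing_choice B) {m n : B}
    {bX aX bY aY bX' aX' bY' aY'}
    (f f' : doubly_marked (@MarkedPath B m bX aX) (@MarkedPath B n bY aY))
    (g g' : doubly_marked (@MarkedPath B m bX' aX') (@MarkedPath B n bY' aY'))
    (x : chosen ch (seg f) ⇒ chosen ch (seg g))
    (x' : chosen ch (seg f') ⇒ chosen ch (seg g'))
    (ef : seg f = seg f') (eg : seg g = seg g') :
  @cell_eq (Dbl_data ch) _ _ _ _ f g eq_refl eq_refl _ _ _ _ f' g' eq_refl eq_refl x x' ->
  ref_cast eg • norm x = norm x' • ref_cast ef.
Proof.
intros E.
assert (f = f') by now apply doubly_marked_eq.
assert (g = g') by now apply doubly_marked_eq.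
subst f' g'.
rewrite (proof_irrelevance _ ef eq_refl), (proof_irrelevance _ eg eq_refl); simpl.
rewrite vcomp1l, vcomp1r. f_equal.
exact (cell_eq_inj E).
Qed.

(** An Eckmann-Hilton argument: interchange splits the horizontal composite into two whiskerings
    with the empty path, and both are trivial after normalisation. *)
Lemma norm_hcomp_binding {B : bicat} (ch : bracketing_choice B) {a : B} {p : path a a}
    (x : chosen ch (pnil a) ⇒ chosen ch p) (y : chosen ch p ⇒ chosen ch (pnil a)) :
  ref_cast (papp_nil p)
    • norm (hcomp_chosen (p := pnil a) (q' := pnil a) y x)
  = norm (x • y).
Proof.
assert (E : hcomp_chosen (p := pnil a) (q' := pnil a) y x
  = hcomp_chosen (q := pnil a) (q' := pnil a) (id2 _) x
      • hcomp_chosen (p := pnil a) (p' := pnil a) y (id2 _))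
  by now rewrite <- hcomp_chosen_interchange, vcomp1l, vcomp1r.
rewrite E, (norm_vcomp (q := pnil a) x y).
etransitivity; [apply f_equal, norm_vcomp|].
rewrite vcompA, norm_hcomp1l, norm_hcomp1r.
rewrite (proof_irrelevance _ (papp_nil (pnil a)) eq_refl); simpl.
now rewrite vcomp1r.
Qed.

(** The horizontal binding equation becomes one inverse law; the vertical one is the other. Hence a
    companion in [Dbl] amounts to an invertible 2-cell to the identity. *)
Lemma hpaste_binding_iff {B : bicat} (ch : bracketing_choice B) {m : B} {bX aX bY aY}
    (f : @hor (Dbl_data ch) (@MarkedPath B m bX aX) (@MarkedPath B m bY aY))
    (x : @cell (Dbl_data ch) _ _ _ _
      (@hid (Dbl_data ch) (@MarkedPath B m bX aX)) f (vid _) eq_refl)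
    (y : @cell (Dbl_data ch) _ _ _ _ f
      (@hid (Dbl_data ch) (@MarkedPath B m bY aY)) eq_refl (vid _)) :
  hpaste y x ≡ one_cell f <-> (x : id1 m ⇒ chosen ch (seg f)) • y = id2 _.
Proof.
simpl in x, y.
split; intros E.
- unshelve epose proof (Dbl_cell_eq_inv _ _ E) as E0; [reflexivity|apply papp_nil|].
  clear E; rename E0 into E.
  simpl in E. apply norm_inj.
  etransitivity; [symmetry; exact (norm_hcomp_binding x y)|].
  etransitivity; [exact E|apply vcomp1r].
- simpl. unshelve eapply Dbl_cell_eq; [reflexivity|apply papp_nil|].
  etransitivity; [exact (norm_hcomp_binding x y)|].
  rewrite vcomp1r. now apply f_equal.
Qed.

Lemma merge_split_inverse {B : bicat} (ch : bracketing_choice B) {a b c : B}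
    (p : path a b) (q : path b c) :
  inverse2 (merge_chosen ch p q) (split_chosen ch p q).
Proof.
unfold merge_chosen, split_chosen; split; rewrite <- !vcompA.
- rewrite (vcK (of_refK ch (papp p q))), (vcK (ref_appK p q)).
  apply hcompK; apply to_refK.
- rewrite (vcK (hcompK (of_refK ch q) (of_refK ch p))), (vcK (ref_app_invK p q)).
  apply to_refK.
Qed.

(** * W-cells satisfy the left and right conditions *)

Lemma counit_lift_of_W_cell {B : bicat} {a b : B} {f g : hom1 a b} {t : f ⇒ g}
    {l m : hom1 b a} {k : f ∘ l ⇒ id1 b} {k' : id1 b ⇒ f ∘ l}
    {n : g ∘ m ⇒ id1 b} {n' : id1 b ⇒ g ∘ m} :
  internal_equivalence f -> internal_equivalence g ->
  W_cell (u := eq_refl) (v := eq_refl) t -> inverse2 k k' -> inverse2 n n' ->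
  counit_lift t k n.
Proof.
intros Hf Hg Ht Hk Hn.
apply (pseudo_inverse_of_counit Hf Hk (Q := fun l k k' => counit_lift t k n)); intros P.
apply (pseudo_inverse_of_counit Hg Hn (Q := fun m n n' => counit_lift t (eps P) n)); intros Q.
destruct (Ht P Q) as (s & _ & E). exists s.
apply (cancel_r (proj1 (eps_inverse P))).
etransitivity; [exact E|symmetry; apply (eps_inverse P)].
Qed.

Lemma unit_lift_of_W_cell {B : bicat} {a b : B} {f g : hom1 a b} {t : f ⇒ g}
    {l m : hom1 b a} {k : id1 a ⇒ l ∘ f} {k' : l ∘ f ⇒ id1 a}
    {n : id1 a ⇒ m ∘ g} {n' : m ∘ g ⇒ id1 a} :
  internal_equivalence f -> internal_equivalence g ->
  W_cell (u := eq_refl) (v := eq_refl) t -> inverse2 k k' -> inverse2 n n' ->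
  unit_lift t k n.
Proof.
intros Hf Hg Ht Hk Hn.
apply (pseudo_inverse_of_unit Hf Hk (Q := fun l k k' => unit_lift t k n)); intros P.
apply (pseudo_inverse_of_unit Hg Hn (Q := fun m n n' => unit_lift t (eta P) n)); intros Q.
destruct (Ht P Q) as (s & E & _). exists s.
apply (cancel_l (proj2 (eta_inverse Q))).
rewrite vcompA. etransitivity; [exact E|symmetry; apply (eta_inverse Q)].
Qed.

(** The left condition in unfolded form: [x], [x2] are vertical isomorphisms, [n], [n2] merging
    cells, [z], [y], [z2], [y2] binding cells. Composed together they are counits for [f] and [g],
    to which the W-cell property applies. The second equation follows from the first by
    invertibility of the binding cells. *)
Lemma counit_lift_conj {B : bicat} {a b : B} {f f' g g' : hom1 a b} {l m : hom1 b a}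
    {p q : hom1 b b} {t : f ⇒ g} {x : f ⇒ f'} {x' : f' ⇒ f} {x2 : g ⇒ g'} {x2' : g' ⇒ g}
    {n : f' ∘ l ⇒ p} {n' : p ⇒ f' ∘ l} {n2 : g' ∘ m ⇒ q} {n2' : q ⇒ g' ∘ m}
    {z : p ⇒ id1 b} {y : id1 b ⇒ p} {z2 : q ⇒ id1 b} {y2 : id1 b ⇒ q} :
  internal_equivalence f -> internal_equivalence g ->
  W_cell (u := eq_refl) (v := eq_refl) t ->
  inverse2 x x' -> inverse2 x2 x2' -> inverse2 n n' -> inverse2 n2 n2' ->
  inverse2 z y -> inverse2 z2 y2 ->
  exists s : l ⇒ m, z2 • (n2 • ((x2 • t • x') ⋆ s) • n') = z
    /\ n2 • ((x2 • t • x') ⋆ s) • n' • y = y2.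
Proof.
intros Hf Hg Ht Hx Hx2 Hn Hn2 Hz Hz2.
assert (I : inverse2 (z • n • (x ⋆ id2 l)) ((x' ⋆ id2 l) • (n' • y)))
  by auto using inverse2_vcomp, inverse2_hcomp, inverse2_id.
assert (I2 : inverse2 (z2 • n2 • (x2 ⋆ id2 m)) ((x2' ⋆ id2 m) • (n2' • y2)))
  by auto using inverse2_vcomp, inverse2_hcomp, inverse2_id.
destruct (counit_lift_of_W_cell Hf Hg Ht I I2) as [s Hs]. exists s.
assert (M : z2 • (n2 • ((x2 • t • x') ⋆ s) • n') = z).
{ assert (E : (x2 • t • x') ⋆ s = (x2 ⋆ id2 m) • ((t ⋆ s) • (x' ⋆ id2 l)))
    by now rewrite <- !interchange, vcomp1l, vcomp1r, <- vcompA.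
  rewrite E, !vcompA, Hs, <- !vcompA.
  rewrite (vcK (hcompK (proj2 Hx) (vcomp1l _))), (proj2 Hn).
  apply vcomp1r. }
split; [exact M|].
apply (cancel_l (proj1 Hz2)).
now rewrite vcompA, M, (proj2 Hz), (proj2 Hz2).
Qed.

(** Dual form for the right condition: the isomorphisms compose to units, and the equation ending in
    [y2] comes first and implies the other. *)
Lemma unit_lift_conj {B : bicat} {a b : B} {f f' g g' : hom1 a b} {l m : hom1 b a}
    {p q : hom1 a a} {t : f ⇒ g} {x : f ⇒ f'} {x' : f' ⇒ f} {x2 : g ⇒ g'} {x2' : g' ⇒ g}
    {n : l ∘ f' ⇒ p} {n' : p ⇒ l ∘ f'} {n2 : m ∘ g' ⇒ q} {n2' : q ⇒ m ∘ g'}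
    {z : p ⇒ id1 a} {y : id1 a ⇒ p} {z2 : q ⇒ id1 a} {y2 : id1 a ⇒ q} :
  internal_equivalence f -> internal_equivalence g ->
  W_cell (u := eq_refl) (v := eq_refl) t ->
  inverse2 x x' -> inverse2 x2 x2' -> inverse2 n n' -> inverse2 n2 n2' ->
  inverse2 z y -> inverse2 z2 y2 ->
  exists s : l ⇒ m, z2 • (n2 • (s ⋆ (x2 • t • x')) • n') = z
    /\ n2 • (s ⋆ (x2 • t • x')) • n' • y = y2.
Proof.
intros Hf Hg Ht Hx Hx2 Hn Hn2 Hz Hz2.
assert (I : inverse2 ((id2 l ⋆ x') • (n' • y)) (z • n • (id2 l ⋆ x)))
  by auto using inverse2_sym, inverse2_vcomp, inverse2_hcomp, inverse2_id.
assert (I2 : inverse2 ((id2 m ⋆ x2') • (n2' • y2)) (z2 • n2 • (id2 m ⋆ x2)))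
  by auto using inverse2_sym, inverse2_vcomp, inverse2_hcomp, inverse2_id.
destruct (unit_lift_of_W_cell Hf Hg Ht I I2) as [s Hs]. exists s.
assert (M : n2 • (s ⋆ (x2 • t • x')) • n' • y = y2).
{ assert (E : s ⋆ (x2 • t • x') = (id2 m ⋆ x2) • ((s ⋆ t) • (id2 l ⋆ x')))
    by now rewrite <- !interchange, vcomp1l, vcomp1r, <- vcompA.
  rewrite E, <- !vcompA, Hs.
  now rewrite (vcK (hcompK (vcomp1l _) (proj2 Hx2))), (vcK (proj2 Hn2)). }
split; [|exact M].
apply (cancel_r (proj1 Hz)).
now rewrite <- !vcompA, !vcompA, <- (vcompA z2), <- (vcompA z2), <- (vcompA z2), M,
  (proj2 Hz), (proj2 Hz2).
Qed.

Ltac trivialize e := assert (e = eq_refl) by apply proof_irrelevance; subst e.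

Lemma left_W_condition_of_W_cell {B : bicat} (ch : bracketing_choice B) {a b : B}
    {bX aX bY aY bX' aX' bY' aY'}
    {h : @hor (Dbl_data ch) (@MarkedPath B a bX aX) (@MarkedPath B b bY aY)}
    {k : @hor (Dbl_data ch) (@MarkedPath B a bX' aX') (@MarkedPath B b bY' aY')}
    {t : chosen ch (seg h) ⇒ chosen ch (seg k)} :
  internal_equivalence (chosen ch (seg h)) -> internal_equivalence (chosen ch (seg k)) ->
  W_cell (u := eq_refl) (v := eq_refl) t ->
  forall p q, @left_W_condition (Dbl_data ch) _ _ _ _ h k eq_refl eq_refl t p q.
Proof.
intros Hh Hk Ht
  [[[m bm am] [n bn an] h' ul ur ul' ur' x x' Kx Kx'] [d bd ad] l [v y z Hy Hz]]
  [[[m2 bm2 am2] [n2 bn2 an2] k' wl wr wl' wr' x2 x2' Kx2 Kx2']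
    [d2 bd2 ad2] l2 [v2 y2 z2 Hy2 Hz2]].
cbn -[cell_eq hpaste] in *.
destruct ul, ur, wl, wr, v, v2.
(* With the other vertical arrows eliminated, these are equalities of a mark with itself. *)
trivialize ul'; trivialize ur'; trivialize wl'; trivialize wr'.
unfold left_W_condition; cbn -[cell_eq].
apply cell_eq_inj in Kx, Kx', Kx2, Kx2', Hz, Hz2.
apply hpaste_binding_iff in Hy, Hy2.
cbn in Kx, Kx', Kx2, Kx2', Hy, Hy2, Hz, Hz2, x, x', x2, x2', y, y2, z, z2.
destruct (counit_lift_conj Hh Hk Ht (conj Kx Kx') (conj Kx2 Kx2')
  (merge_split_inverse ch (seg l) (seg h')) (merge_split_inverse ch (seg l2) (seg k'))
  (conj Hy Hz) (conj Hy2 Hz2)) as (s & E & E').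
exists eq_refl, s.
split; apply cell_eq_of_eq; cbn.
- etransitivity; [exact E|symmetry; apply vcomp1l].
- etransitivity; [exact E'|symmetry; apply vcomp1r].
Qed.

Lemma right_W_condition_of_W_cell {B : bicat} (ch : bracketing_choice B) {a b : B}
    {bX aX bY aY bX' aX' bY' aY'}
    {h : @hor (Dbl_data ch) (@MarkedPath B a bX aX) (@MarkedPath B b bY aY)}
    {k : @hor (Dbl_data ch) (@MarkedPath B a bX' aX') (@MarkedPath B b bY' aY')}
    {t : chosen ch (seg h) ⇒ chosen ch (seg k)} :
  internal_equivalence (chosen ch (seg h)) -> internal_equivalence (chosen ch (seg k)) ->
  W_cell (u := eq_refl) (v := eq_refl) t ->
  forall p q, @right_W_condition (Dbl_data ch) _ _ _ _ h k eq_refl eq_refl t p q.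
Proof.
intros Hh Hk Ht
  [[[m bm am] [n bn an] h' ul ur ul' ur' x x' Kx Kx'] [d bd ad] l [v y z Hy Hz]]
  [[[m2 bm2 am2] [n2 bn2 an2] k' wl wr wl' wr' x2 x2' Kx2 Kx2']
    [d2 bd2 ad2] l2 [v2 y2 z2 Hy2 Hz2]].
cbn -[cell_eq hpaste] in *.
destruct ul, ur, wl, wr, v, v2.
trivialize ul'; trivialize ur'; trivialize wl'; trivialize wr'.
unfold right_W_condition; cbn -[cell_eq].
apply cell_eq_inj in Kx, Kx', Kx2, Kx2', Hz, Hz2.
apply hpaste_binding_iff in Hy, Hy2.
cbn in Kx, Kx', Kx2, Kx2', Hy, Hy2, Hz, Hz2, x, x', x2, x2', y, y2, z, z2.
destruct (unit_lift_conj Hh Hk Ht (conj Kx Kx') (conj Kx2 Kx2')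
  (merge_split_inverse ch (seg h') (seg l)) (merge_split_inverse ch (seg k') (seg l2))
  (conj Hy Hz) (conj Hy2 Hz2)) as (s & E & E').
exists eq_refl, s.
split; apply cell_eq_of_eq; cbn.
- etransitivity; [exact E|symmetry; apply vcomp1l].
- etransitivity; [exact E'|symmetry; apply vcomp1r].
Qed.

(** * The left and right conditions imply the W-cell property *)

(** Horizontal arrows compose only along a common path, and the path of a given segment need not
    contain a pseudo-inverse of it. The segment is therefore copied into a longer path, marked at
    its ends and at the junction. *)
Definition mark_start {B : bicat} {a b c : B} (p : path a b) (q : path b c) :
    marked_path B :=
  MarkedPath (existT _ a (pnil a)) (existT _ c (papp p q)).

Definition mark_middle {B : bicat} {a b c : B} (p : path a b) (q : path b c) :
    marked_path B :=
  MarkedPath (existT _ a p) (existT _ c q).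

Definition mark_end {B : bicat} {a b c : B} (p : path a b) (q : path b c) :
    marked_path B :=
  MarkedPath (existT _ a (papp p q)) (existT _ c (pnil c)).

Definition first_part {B : bicat} {a b c : B} (p : path a b) (q : path b c) :
    doubly_marked (mark_start p q) (mark_middle p q) :=
  @DoublyMarked B (mark_start p q) (mark_middle p q) p eq_refl eq_refl.

Definition last_part {B : bicat} {a b c : B} (p : path a b) (q : path b c) :
    doubly_marked (mark_middle p q) (mark_end p q).
Proof.
refine (@DoublyMarked B (mark_middle p q) (mark_end p q) q eq_refl _).
unfold app_after; simpl. now rewrite papp_nil.
Defined.

(** As [ch] is arbitrary, its composite of a one-arrow path does not reduce to the arrow. Passing
    through the reference composite [id1 b ∘ f] avoids a dependent inversion of the bracketing. *)
Definition chosen_arrow {B : bicat} (ch : bracketing_choice B) {a b : B}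
    (f : hom1 a b) : chosen ch (pcons f (pnil b)) ⇒ f :=
  lunit f • to_ref ch (pcons f (pnil b)).

Definition chosen_arrow_inv {B : bicat} (ch : bracketing_choice B) {a b : B}
    (f : hom1 a b) : f ⇒ chosen ch (pcons f (pnil b)) :=
  of_ref ch (pcons f (pnil b)) • lunit_inv f.

Lemma chosen_arrow_inverse {B : bicat} (ch : bracketing_choice B) {a b : B}
    (f : hom1 a b) : inverse2 (chosen_arrow ch f) (chosen_arrow_inv ch f).
Proof.
apply inverse2_vcomp; [apply inverse2_lunit|].
exact (conj (to_refK ch (pcons f (pnil b))) (of_refK ch (pcons f (pnil b)))).
Qed.

Definition binding_companion {B : bicat} (ch : bracketing_choice B) {m : B}
    {bX aX bY aY} (f : @hor (Dbl_data ch) (@MarkedPath B m bX aX) (@MarkedPath B m bY aY))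
    (z : chosen ch (seg f) ⇒ id1 m) (y : id1 m ⇒ chosen ch (seg f))
    (H : inverse2 z y) : companion f.
Proof.
refine (@Companion (Dbl_data ch) _ _ f eq_refl y z _ _).
- exact (proj2 (hpaste_binding_iff (f := f) y z) (proj1 H)).
- apply cell_eq_of_eq. exact (proj2 H).
Defined.

(** The path runs through [star P] and then the segment of [h]. The copy of [h] is joined to [h] by
    the identity 2-cell, and [eps P] provides the binding cell chi. *)
Definition left_choice_of {B : bicat} (ch : bracketing_choice B) {a b : B} {bX aX bY aY}
    {h : @hor (Dbl_data ch) (@MarkedPath B a bX aX) (@MarkedPath B b bY aY)}
    (P : pseudo_inverse (chosen ch (seg h))) : left_choice h.
Proof.
pose (q := pcons (star P) (pnil a)).
unshelve refine (@LeftChoice (Dbl_data ch) _ _ h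
  (@VerticalIso (Dbl_data ch) _ _ h (mark_middle q (seg h)) (mark_end q (seg h))
    (last_part q (seg h)) eq_refl eq_refl eq_refl eq_refl (id2 _) (id2 _) _ _)
  (mark_start q (seg h)) (first_part q (seg h))
  (@binding_companion B ch b _ _ _ _
    (@hseq (Dbl_data ch) _ _ _ (last_part q (seg h)) (first_part q (seg h)))
    (eps P • (id2 _ ⋆ chosen_arrow ch (star P)) • split_chosen ch q (seg h))
    (merge_chosen ch q (seg h) • ((id2 _ ⋆ chosen_arrow_inv ch (star P)) • eps_inv P)) _)).
- apply cell_eq_of_eq, vcomp1l.
- apply cell_eq_of_eq, vcomp1l.
- apply inverse2_vcomp; [apply inverse2_vcomp|].
  + apply eps_inverse.
  + apply inverse2_hcomp; [apply inverse2_id|apply chosen_arrow_inverse].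
  + apply inverse2_sym, merge_split_inverse.
Defined.

(** Here [star P] follows the segment, and [eta P] provides the binding cell psi. *)
Definition right_choice_of {B : bicat} (ch : bracketing_choice B) {a b : B} {bX aX bY aY}
    {h : @hor (Dbl_data ch) (@MarkedPath B a bX aX) (@MarkedPath B b bY aY)}
    (P : pseudo_inverse (chosen ch (seg h))) : right_choice h.
Proof.
pose (q := pcons (star P) (pnil a)).
unshelve refine (@RightChoice (Dbl_data ch) _ _ h
  (@VerticalIso (Dbl_data ch) _ _ h (mark_start (seg h) q) (mark_middle (seg h) q)
    (first_part (seg h) q) eq_refl eq_refl eq_refl eq_refl (id2 _) (id2 _) _ _)
  (mark_end (seg h) q) (last_part (seg h) q)
  (@binding_companion B ch a _ _ _ _
    (@hseq (Dbl_data ch) _ _ _ (last_part (seg h) q) (first_part (seg h) q))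
    (eta_inv P • (chosen_arrow ch (star P) ⋆ id2 _) • split_chosen ch (seg h) q)
    (merge_chosen ch (seg h) q • ((chosen_arrow_inv ch (star P) ⋆ id2 _) • eta P)) _)).
- apply cell_eq_of_eq, vcomp1l.
- apply cell_eq_of_eq, vcomp1l.
- apply inverse2_vcomp; [apply inverse2_vcomp|].
  + apply inverse2_sym, eta_inverse.
  + apply inverse2_hcomp; [apply chosen_arrow_inverse|apply inverse2_id].
  + apply inverse2_sym, merge_split_inverse.
Defined.

(** The hypothesis is the chi equation for choices made from counits. The merging cells cancel, and
    conjugation by comparison cells of one-arrow paths moves the lift to the original inverses. *)
Lemma counit_lift_unconj {B : bicat} {a b : B} {f g : hom1 a b} {t : f ⇒ g}
    {l l' m m' : hom1 b a} {p q : hom1 b b}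
    {c : l' ⇒ l} {c' : l ⇒ l'} {d : m' ⇒ m}
    {k : f ∘ l ⇒ id1 b} {k2 : g ∘ m ⇒ id1 b}
    {n : f ∘ l' ⇒ p} {n' : p ⇒ f ∘ l'} {n2 : g ∘ m' ⇒ q} {n2' : q ⇒ g ∘ m'}
    {s : l' ⇒ m'} :
  c • c' = id2 l -> inverse2 n n' -> inverse2 n2 n2' ->
  k2 • (id2 g ⋆ d) • n2' • (n2 • ((id2 g • t • id2 f) ⋆ s) • n')
    = id2 _ • (k • (id2 f ⋆ c) • n') ->
  k2 • (t ⋆ (d • s • c')) = k.
Proof.
intros Hc Hn Hn2 E.
rewrite vcomp1l, vcomp1r, vcomp1l in E.
rewrite <- !vcompA, (vcK (proj1 Hn2)), !vcompA in E.
apply (cancel_r (proj2 (inverse2_sym Hn))) in E.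
assert (E' : t ⋆ (d • s • c') = (id2 g ⋆ d) • ((t ⋆ s) • (id2 f ⋆ c')))
  by now rewrite <- !interchange, vcomp1l, vcomp1r, <- vcompA.
rewrite E', !vcompA, E, <- vcompA, <- interchange, vcomp1l, Hc, hcomp1.
apply vcomp1r.
Qed.

Lemma unit_lift_unconj {B : bicat} {a b : B} {f g : hom1 a b} {t : f ⇒ g}
    {l l' m m' : hom1 b a} {p q : hom1 a a}
    {c' : l ⇒ l'} {d : m' ⇒ m} {d' : m ⇒ m'}
    {k : id1 a ⇒ l ∘ f} {k2 : id1 a ⇒ m ∘ g}
    {n : l' ∘ f ⇒ p} {n' : p ⇒ l' ∘ f} {n2 : m' ∘ g ⇒ q} {n2' : q ⇒ m' ∘ g}
    {s : l' ⇒ m'} :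
  d • d' = id2 m -> inverse2 n n' -> inverse2 n2 n2' ->
  n2 • (s ⋆ (id2 g • t • id2 f)) • n' • (n • ((c' ⋆ id2 f) • k))
    = n2 • ((d' ⋆ id2 g) • k2) • id2 _ ->
  ((d • s • c') ⋆ t) • k = k2.
Proof.
intros Hd Hn Hn2 E.
rewrite vcomp1l, !vcomp1r in E.
rewrite <- !vcompA, (vcK (proj1 Hn)) in E.
apply (cancel_l (proj1 Hn2)) in E.
assert (E' : (d • s • c') ⋆ t = (d ⋆ id2 g) • ((s ⋆ t) • (c' ⋆ id2 f)))
  by now rewrite <- !interchange, vcomp1l, vcomp1r, <- vcompA.
rewrite E', <- !vcompA, E.
apply (vcK (hcompK Hd (vcomp1l _))).
Qed.

Lemma W_cell_of_W_conditions {B : bicat} (ch : bracketing_choice B) {a b : B}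
    {bX aX bY aY bX' aX' bY' aY'}
    {h : @hor (Dbl_data ch) (@MarkedPath B a bX aX) (@MarkedPath B b bY aY)}
    {k : @hor (Dbl_data ch) (@MarkedPath B a bX' aX') (@MarkedPath B b bY' aY')}
    {t : chosen ch (seg h) ⇒ chosen ch (seg k)} :
  (forall p q, @left_W_condition (Dbl_data ch) _ _ _ _ h k eq_refl eq_refl t p q) ->
  (forall p q, @right_W_condition (Dbl_data ch) _ _ _ _ h k eq_refl eq_refl t p q) ->
  W_cell (u := eq_refl) (v := eq_refl) t.
Proof.
intros HL HR P Q.
(* The chi equation of the left condition concerns counits, the psi equation of the right condition
   units. *)
destruct (HL (left_choice_of (h := h) P) (@left_choice_of B ch a b _ _ _ _ k Q))
  as (s & al & E & _).
destruct (HR (right_choice_of (h := h) P) (@right_choice_of B ch a b _ _ _ _ k Q))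
  as (s' & ar & _ & E').
clear HL HR.
cbn in s, s'.
trivialize s; trivialize s'.
apply cell_eq_inj in E, E'.
pose proof (counit_lift_unconj (proj2 (chosen_arrow_inverse ch (star P)))
  (merge_split_inverse _ _ _) (merge_split_inverse _ _ _) E) as F.
pose proof (unit_lift_unconj (proj2 (chosen_arrow_inverse ch (star Q)))
  (merge_split_inverse _ _ _) (merge_split_inverse _ _ _) E') as F'.
(* The lift from the left condition is the witness; it satisfies the unit equation because it equals
   the lift from [ar]. *)
exists (chosen_arrow ch (star Q) • al • chosen_arrow_inv ch (star P)).
exact (adjoint_lift F F').
Qed.

Lemma W_conditions_iff {B : bicat} (ch : bracketing_choice B) {a a' b b' : B}
    {u : a = a'} {v : b = b'} {bX aX bY aY bX' aX' bY' aY'}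
    {h : @hor (Dbl_data ch) (@MarkedPath B a bX aX) (@MarkedPath B b bY aY)}
    {k : @hor (Dbl_data ch) (@MarkedPath B a' bX' aX') (@MarkedPath B b' bY' aY')}
    {t : hom2_over u v (chosen ch (seg h)) (chosen ch (seg k))} :
  internal_equivalence (chosen ch (seg h)) -> internal_equivalence (chosen ch (seg k)) ->
  W_cell t <->
  (forall p q, @left_W_condition (Dbl_data ch) _ _ _ _ h k u v t p q) /\
  (forall p q, @right_W_condition (Dbl_data ch) _ _ _ _ h k u v t p q).
Proof.
destruct u, v; intros Hh Hk; split.
- intros H. split.
  + exact (left_W_condition_of_W_cell Hh Hk H).
  + exact (right_W_condition_of_W_cell Hh Hk H).
- intros [HL HR]. exact (W_cell_of_W_conditions HL HR).
Qed.

(** * Invariance of W-cells under isomorphism, and components of icons along paths *)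

Lemma internal_equivalence_of_pseudo_inverse {B : bicat} {a b : B} {f : hom1 a b} :
  pseudo_inverse f -> internal_equivalence f.
Proof.
intros P. exists (star P), (eta P), (eta_inv P), (eps P), (eps_inv P).
split; [apply eta_inverse|apply eps_inverse].
Qed.

(** Adjoint inverses of [f'] and [g'] give counits and units for [f] and [g] by composing with [x]
    and [y]. This yields a counit lift and a unit lift, which [adjoint_lift] merges. *)
Lemma W_cell_iso {B : bicat} {a b : B} {f f' g g' : hom1 a b}
    {t : f ⇒ g} {t' : f' ⇒ g'} {x : f ⇒ f'} {x' : f' ⇒ f} {y : g ⇒ g'} {y' : g' ⇒ g} :
  inverse2 x x' -> inverse2 y y' -> y • t = t' • x ->
  W_cell (u := eq_refl) (v := eq_refl) t -> W_cell (u := eq_refl) (v := eq_refl) t'.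
Proof.
intros Hx Hy E H P Q.
assert (Hf : internal_equivalence f).
{ apply (@internal_equivalence_iso _ _ _ f'); [now exists x', x; apply inverse2_sym|].
  now apply internal_equivalence_of_pseudo_inverse. }
assert (Hg : internal_equivalence g).
{ apply (@internal_equivalence_iso _ _ _ g'); [now exists y', y; apply inverse2_sym|].
  now apply internal_equivalence_of_pseudo_inverse. }
assert (E' : y • t • x' = t') by now rewrite E, <- vcompA, (proj2 Hx), vcomp1r.
destruct (counit_lift_conj Hf Hg H Hx Hy (inverse2_id _) (inverse2_id _)
  (eps_inverse P) (eps_inverse Q)) as (s & F & _).
destruct (unit_lift_conj Hf Hg H Hx Hy (inverse2_id _) (inverse2_id _)
  (inverse2_sym (eta_inverse P)) (inverse2_sym (eta_inverse Q))) as (s' & _ & F').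
rewrite E', vcomp1l, vcomp1r in F, F'.
exists s. exact (adjoint_lift F F').
Qed.

Lemma coh_inverse {B D : bicat} (chB : bracketing_choice B) (chD : bracketing_choice D)
    (F : homomorphism B D) {a b : B} (p : path a b) :
  inverse2 (coh chB chD F p) (coh_inv chB chD F p).
Proof.
unfold coh, coh_inv; rewrite <- vcompA.
repeat apply inverse2_vcomp; split;
  rewrite <- ?h_vcomp, ?of_refK, ?to_refK, ?h_id2;
  auto using ref_mapK, ref_map_invK.
Qed.

(** Reference composites are handled by [ref_map_icon], and the passage to chosen composites by
    naturality of [psi]. The resulting square feeds [W_cell_iso]. *)
Lemma coh_icon {B D : bicat} (chB : bracketing_choice B) (chD : bracketing_choice D)
    {F G : homomorphism B D} (psi : icon F G) {a b : B} (p : path a b) :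
  conj_over (coh chB chD G p) (icon_path chD psi p) (id2 _)
  = conj_over (id2 _) (ic_1 psi (chosen chB p)) (coh chB chD F p).
Proof.
unfold icon_path, coh.
pose proof (ref_map_icon psi p) as E.
pose proof (ic_nat psi (of_ref chB p)) as E'.
revert E E'. generalize (icon_ref psi p) (ref_map G p) (ref_map F p).
open_icon F G psi. intros r M M' E E'.
rewrite !vcomp1l, !vcomp1r in *.
rewrite <- !vcompA, (vcK (of_refK _ _)), (vc2 E), !vcompA, E'.
reflexivity.
Qed.

Lemma W_cell_icon {B D : bicat} (chB : bracketing_choice B) (chD : bracketing_choice D)
    {F G : homomorphism B D} (psi : icon F G) {a b : B} (p : path a b) :
  W_cell (icon_path chD psi p) <-> W_cell (ic_1 psi (chosen chB p)).
Proof.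
pose proof (coh_icon chB chD psi p) as E.
pose proof (coh_inverse chB chD F p) as I.
pose proof (coh_inverse chB chD G p) as J.
revert E I J.
generalize (icon_path chD psi p) (coh chB chD F p) (coh chB chD G p)
  (coh_inv chB chD F p) (coh_inv chB chD G p).
(* Once the object maps are identified, the components of [psi] are ordinary 2-cells. *)
open_icon F G psi. intros t x y x' y' E I J.
rewrite vcomp1l, vcomp1r in E.
split.
- exact (W_cell_iso I J E).
- refine (W_cell_iso (inverse2_sym I) (inverse2_sym J) _).
  apply (cancel_l (proj1 J)).
  now rewrite vcompA, (proj2 J), vcomp1l, vcompA, E, <- vcompA, (proj2 I), vcomp1r.
Qed.

(** * W-icons and vertical W-transformations *)

Lemma chosen_pmap_equivalence {C : category} (W : arrow_class C) (D : bicat)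
    (F : homomorphism (locally_discrete C) D) (chC : bracketing_choice (locally_discrete C))
    (chD : bracketing_choice D) {a b : C} (p : @path (locally_discrete C) a b) :
  W_homomorphism W F -> W a b (chosen chC p) ->
  internal_equivalence (chosen chD (pmap F p)).
Proof.
intros HF Hp. refine (internal_equivalence_iso _ (HF _ _ _ Hp)).
exists (coh_inv chC chD F p), (coh chC chD F p). apply inverse2_sym, coh_inverse.
Qed.

Unset Implicit Arguments.

Theorem lemma4p10
    (C : category) (W : arrow_class C)
    (W_CF1 : CF1 W) (W_CF2 : CF2 W) (W_CF3 : CF3 W)
    (D : bicat) (F G : homomorphism (locally_discrete C) D)
    (F_W : W_homomorphism W F) (G_W : W_homomorphism W G)
    (chC : bracketing_choice (locally_discrete C)) (chD : bracketing_choice D)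
    (psi : icon F G) :
  W_icon W psi <-> vertical_W_transformation W (Dbl_transformation chC chD psi).
Proof.
split.
- intros H X Y w Hw.
  apply (W_conditions_iff (h := dm_map F w) (k := dm_map G w));
    [exact (chosen_pmap_equivalence chD F_W Hw)
    |exact (chosen_pmap_equivalence chD G_W Hw)|].
  apply (W_cell_icon chC). exact (H _ _ _ Hw).
- intros H A B w Hw.
  (* The arrow [w] is realised as a one-arrow path marked at both ends. *)
  set (p := @pcons (locally_discrete C) A B B w (@pnil (locally_discrete C) B)).
  set (m := @last_part (locally_discrete C) A A B (@pnil (locally_discrete C) A) p).
  (* A 2-cell of a locally discrete bicategory is an equality of arrows, so the comparison cell can
     be used for rewriting. *)
  pose proof (@chosen_arrow (locally_discrete C) chC A B w : chosen chC p = w) as E.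
  assert (Hp : W A B (chosen chC p)) by now rewrite E.
  enough (K : W_cell (ic_1 psi (chosen chC p))) by now rewrite E in K.
  apply (W_cell_icon chC chD).
  apply (W_conditions_iff (h := dm_map F m) (k := dm_map G m));
    [exact (chosen_pmap_equivalence chD F_W Hp)
    |exact (chosen_pmap_equivalence chD G_W Hp)|].
  exact (H _ _ m Hp).
Qed.
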